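(* Let $(H,R)$ be a semisimple quasi-triangular Hopf algebra over a field $k$ of characteristic zero. Let $A$ be a strongly separable quantum commutative $H$-simple left $H$-module algebra such that the Drinfeld element $u=S(R^2)R^1$ acts on $A$ trivially. Then for any nonzero $V\in{}_{A\#H}\mathcal M$, $$\dim A\mid\dim V\quad\text{and}\quad\operatorname{FPdim}V=\frac{\dim V}{\dim A}.$$
   Context: $S$ is the antipode of $H$; Sweedler notation is used. A quasi-triangular Hopf algebra is a pair $(H,R)$, $R=R^1\otimes R^2\in H\otimes H$ invertible, with $R^1h_{(1)}\otimes R^2h_{(2)}=h_{(2)}R^1\otimes h_{(1)}R^2$ for all $h\in H$, $(\Delta\otimes id)(R)=R^{13}R^{23}$, $(id\otimes\Delta)(R)=R^{13}R^{12}$. A left $H$-module algebra $A$ is quantum commutative if $ab=(R^2\cdot b)(R^1\cdot a)$ for all $a,b\in A$; it is $H$-simple if it contains no non-trivial $H$-stable two-sided ideal. $A$ is strongly separable if it has a symmetric separability idempotent $x=x^1\otimes x^2\in A\otimes A$, i.e. $ax^1\otimes x^2=x^1\otimes x^2a$, $x^1x^2=1_A$, $x^1\otimes x^2=x^2\otimes x^1$. The element $u$ acts trivially on $A$ if $u\cdot a=a$ for all $a\in A$. $A\#H$ is $A\otimes H$ with product $(a\#h)(b\#g)=a(h_{(1)}\cdot b)\#h_{(2)}g$. ${}_{A\#H}\mathcal M$ is the category of finite dimensional left $A\#H$-modules, monoidal as follows: each left $A\#H$-module $M$ is an $A$-$A$-bimodule with $a\cdot m=(a\#1_H)m$, $m\cdot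 a=((R^2\cdot a)\#R^1)m$, and the tensor product is $M\otimes_AN$ with $(a\#h)(m\otimes n)=(a\#h_{(1)})m\otimes(1_A\#h_{(2)})n$; the unit is $A$. (Under the hypotheses $A\#H$ is a weak Hopf algebra inducing this monoidal structure, and ${}_{A\#H}\mathcal M$ is a fusion category.) For an object $X$ of a fusion category $\mathcal C$, $\operatorname{FPdim}X$ is the largest positive eigenvalue of the matrix of left or right multiplication by the class $[X]$ in the Grothendieck ring $\operatorname{Gr}(\mathcal C)$, with respect to the basis of isomorphism classes of simple objects. *)

(* Defs.v *)
From HB Require Import structures.
From mathcomp Require Import all_boot all_order all_algebra all_field.

Set Implicit Arguments.
Unset Strict Implicit.
Unset Printing Implicit Defensive.

Import GRing.Theory Num.Theory.
Local Open Scope ring_scope.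

(* The tensor product of two finite-dimensional spaces is modelled by the     *)
(* matrices of coordinates with respect to the bases [vbasis fullv].          *)
Definition tensor (k : fieldType) (U V : vectType k) : vectType k :=
  'M[k]_(\dim {:U}, \dim {:V}).

Definition tens (k : fieldType) (U V : vectType k) (u : U) (v : V) :
    tensor U V :=
  \matrix_(i, j) (coord (vbasis {:U}) i u * coord (vbasis {:V}) j v).

Notation "u \ox v" := (tens u v) (at level 40, left associativity).

(* [sweedler t f] is the image of t under the linear map U (x) V -> W induced *)
(* by a bilinear f (see [sweedler_tens]); it is only meaningful for such f.   *)
(* [\sw_(x, y <- t) E] renders the usual notation E(t^1, t^2), and            *)
(* [\sw_(x, y <- Delta h) E] renders E(h_(1), h_(2)).                         *)
Definition sweedler (k : fieldType) (U V : vectType k) (W : lmodType k)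
    (t : tensor U V) (f : U -> V -> W) : W :=
  \sum_i \sum_j (t : 'M[k]_(\dim {:U}, \dim {:V})) i j *:
    f (vbasis {:U})`_i (vbasis {:V})`_j.

Notation "'\sw_' ( x , y '<-' t ) E" := (sweedler t (fun x y => E))
  (at level 41, x name, y name, t at level 99, E at level 41,
   format "'\sw_' ( x ,  y  '<-'  t )  E").

Lemma sweedler_tens (k : fieldType) (U V : vectType k) (W : lmodType k)
    (f : U -> V -> W) (u : U) (v : V) :
  (forall y, linear (f^~ y)) -> (forall x, linear (f x)) ->
  \sw_(x, y <- u \ox v) f x y = f u v.
Proof.
move=> linl linr.
have lin_sum (T : vectType k) (g : T -> W) (w : T) : linear g ->
    g w = \sum_i coord (vbasis {:T}) i w *: g (vbasis {:T})`_i.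
  move=> ling; pose gL := GRing.isLinear.Build _ _ _ _ g ling.
  pose g' : {linear T -> W} := HB.pack g gL.
  rewrite -[g w]/(g' w) {1}(coord_vbasis (memvf w)) linear_sum.
  by apply: eq_bigr => i _; rewrite linearZ.
rewrite /sweedler (lin_sum _ (f^~ v) u (linl v)).
apply: eq_bigr => i _; rewrite (lin_sum _ (f _) v (linr _)) scaler_sumr.
by apply: eq_bigr => j _; rewrite /tens mxE scalerA.
Qed.

Definition tensor_mul (k : fieldType) (B C : falgType k) (s t : tensor B C) :
    tensor B C :=
  \sw_(a, b <- s) \sw_(c, d <- t) ((a * c) \ox (b * d)).

Record hopfAlgebra (k : fieldType) := HopfAlgebra {
  hopf_alg :> falgType k;
  Delta : {linear hopf_alg -> tensor hopf_alg hopf_alg};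
  counit : {linear hopf_alg -> k^o};
  antipode : {linear hopf_alg -> hopf_alg};
  Delta_coassoc : forall h,
    \sw_(x, z <- Delta h) \sw_(a, b <- Delta x) ((a \ox b) \ox z) =
    \sw_(a, y <- Delta h) \sw_(b, z <- Delta y) ((a \ox b) \ox z);
  Delta_counitl : forall h, \sw_(x, y <- Delta h) (counit x *: y) = h;
  Delta_counitr : forall h, \sw_(x, y <- Delta h) (counit y *: x) = h;
  Delta1 : Delta 1 = 1 \ox 1;
  DeltaM : forall g h, Delta (g * h) = tensor_mul (Delta g) (Delta h);
  counit1 : counit 1 = 1;
  counitM : forall g h, counit (g * h) = counit g * counit h;
  antipodel : forall h,
    \sw_(x, y <- Delta h) (antipode x * y) = counit h *: 1;
  antipoder : forall h,
    \sw_(x, y <- Delta h) (x * antipode y) = counit h *: 1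
}.

Arguments Delta {k H} : rename.
Arguments counit {k H} : rename.
Arguments antipode {k H} : rename.

Definition left_ideal (k : fieldType) (B : falgType k) (I : {vspace B}) :=
  forall b x, x \in I -> b * x \in I.

Definition simple_left_ideal (k : fieldType) (B : falgType k)
    (I : {vspace B}) :=
  [/\ left_ideal I, I <> 0%VS &
      forall J : {vspace B}, left_ideal J -> (J <= I)%VS -> J = 0%VS \/ J = I].

(* The left regular module is a direct sum of simple submodules. *)
Definition semisimple_algebra (k : fieldType) (B : falgType k) :=
  exists (n : nat) (I : 'I_n -> {vspace B}),
    [/\ forall i, simple_left_ideal (I i), directv (\sum_i I i)
      & (\sum_i I i)%VS = fullv].

Section QuasiTriangular.

Context (k : fieldType) (H : hopfAlgebra k) (R : tensor H H).

(* The last two fields are (Delta (x) id)(R) = R^13 R^23 and                  *)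
(* (id (x) Delta)(R) = R^13 R^12 in H (x) H (x) H.                            *)
Record quasitriangular : Prop := QuasiTriangular {
  qt_inv : exists R' : tensor H H,
    tensor_mul R R' = 1 \ox 1 /\ tensor_mul R' R = 1 \ox 1;
  qt_Delta : forall h : H,
    \sw_(r1, r2 <- R) \sw_(h1, h2 <- Delta h) ((r1 * h1) \ox (r2 * h2)) =
    \sw_(r1, r2 <- R) \sw_(h1, h2 <- Delta h) ((h2 * r1) \ox (h1 * r2));
  qt_Deltal :
    \sw_(r1, r2 <- R) \sw_(a, b <- Delta r1) ((a \ox b) \ox r2) =
    \sw_(r1, r2 <- R) \sw_(s1, s2 <- R) ((r1 \ox s1) \ox (r2 * s2));
  qt_Deltar :
    \sw_(r1, r2 <- R) \sw_(a, b <- Delta r2) ((r1 \ox a) \ox b) =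
    \sw_(r1, r2 <- R) \sw_(s1, s2 <- R) (((r1 * s1) \ox s2) \ox r2)
}.

Definition drinfeld : H := \sw_(r1, r2 <- R) (antipode r2 * r1).

End QuasiTriangular.

Record moduleAlgebra (k : fieldType) (H : hopfAlgebra k) := ModuleAlgebra {
  modalg_alg :> falgType k;
  act : {linear H -> 'End(modalg_alg)};
  act1 : forall a, act 1 a = a;
  actM : forall g h a, act (g * h) a = act g (act h a);
  act_mul : forall h a b,
    act h (a * b) = \sw_(h1, h2 <- Delta h) (act h1 a * act h2 b);
  act_unit : forall h, act h 1 = counit h *: 1
}.

Arguments act {k H A} : rename.

Section ModuleAlgebraTheory.

Context (k : fieldType) (H : hopfAlgebra k) (A : moduleAlgebra H).

Definition quantum_commutative (R : tensor H H) :=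
  forall a b : A, a * b = \sw_(r1, r2 <- R) (act r2 b * act r1 a).

Definition H_simple :=
  forall I : {vspace A},
    (forall a b x, x \in I -> a * x * b \in I) ->
    (forall h x, x \in I -> act h x \in I) ->
    I = 0%VS \/ I = fullv.

Definition smash_mul (s t : tensor A H) : tensor A H :=
  \sw_(a, h <- s) \sw_(b, g <- t)
    \sw_(h1, h2 <- Delta h) ((a * act h1 b) \ox (h2 * g)).

Record smashModule := SmashModule {
  smash_space :> vectType k;
  sact : {linear tensor A H -> 'End(smash_space)};
  sact1 : forall m, sact (1 \ox 1) m = m;
  sactM : forall s t m, sact (smash_mul s t) m = sact s (sact t m)
}.

Definition smash_hom (M N : smashModule) (f : 'Hom(M, N)) :=
  forall s m, f (sact _ s m) = sact _ s (f m).

Definition smash_iso (M N : smashModule) :=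
  exists f : 'Hom(M, N), smash_hom f /\ bijective f.

Definition smash_simple (M : smashModule) :=
  fullv <> 0%VS :> {vspace M} /\
  forall U : {vspace M},
    (forall s m, m \in U -> sact M s m \in U) -> U = 0%VS \/ U = fullv.

End ModuleAlgebraTheory.

Arguments sact {k H A} M : rename.

Definition strongly_separable (k : fieldType) (A : falgType k) :=
  exists x : tensor A A,
    [/\ forall a, \sw_(x1, x2 <- x) ((a * x1) \ox x2) =
                  \sw_(x1, x2 <- x) (x1 \ox (x2 * a)),
        \sw_(x1, x2 <- x) (x1 * x2) = 1
      & x = \sw_(x1, x2 <- x) (x2 \ox x1)].

Section MonoidalStructure.

Context (k : fieldType) (H : hopfAlgebra k) (R : tensor H H).
Context (A : moduleAlgebra H).

Definition lmulA (M : smashModule A) (a : A) (m : M) : M :=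
  sact M (a \ox (1 : H)) m.

Definition rmulA (M : smashModule A) (m : M) (a : A) : M :=
  sact M (\sw_(r1, r2 <- R) (act r2 a \ox r1)) m.

Definition balanced (M N : smashModule A) (W : vectType k)
    (p : 'Hom(tensor M N, W)) :=
  forall m a n, p (rmulA m a \ox n) = p (m \ox lmulA a n).

(* The A#H-module T is the tensor product of M and N over A: p is the         *)
(* canonical projection of M (x) N onto M (x)_A N, characterised by the       *)
(* universal property, and A#H acts through Delta.                            *)
Record tensor_over_A (M N T : smashModule A) (p : 'Hom(tensor M N, T)) : Prop
    := TensorOverA {
  toA_balanced : balanced p;
  toA_universal : forall (W : vectType k) (q : 'Hom(tensor M N, W)),
    balanced q -> exists! f : 'Hom(T, W), forall t, q t = f (p t);
  toA_sact : forall (a : A) (h : H) m n,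
    sact T (a \ox h) (p (m \ox n)) =
    \sw_(h1, h2 <- Delta h)
      p (sact M (a \ox h1) m \ox sact N ((1 : A) \ox h2) n)
}.

(* A system of representatives of the isomorphism classes of simple objects,  *)
(* i.e. the standard basis of the Grothendieck ring.                          *)
Definition simple_system (r : nat) (X : 'I_r -> smashModule A) :=
  [/\ forall i, smash_simple (X i),
      forall i j, smash_iso (X i) (X j) -> i = j
    & forall M : smashModule A, smash_simple M -> exists i, smash_iso M (X i)].

(* [M] = \sum_j c j [X j] in the Grothendieck ring: M is the internal direct  *)
(* sum of images of embeddings of X j, with c j summands for each j.          *)
Definition Gr_class (r : nat) (X : 'I_r -> smashModule A)
    (M : smashModule A) (c : 'I_r -> nat) :=
  exists f : forall j : 'I_r, 'I_(c j) -> 'Hom(X j, M),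
    let img (p : {j : 'I_r & 'I_(c j)}) := limg (f (tag p) (tagged p)) in
    [/\ forall j l, smash_hom (f j l) /\ injective (f j l),
        directv (\sum_p img p) & (\sum_p img p)%VS = fullv].

(* [M][N] = \sum_j c j [X j], the product being [M][N] = [M (x)_A N]. *)
Definition Gr_mul (r : nat) (X : 'I_r -> smashModule A)
    (M N : smashModule A) (c : 'I_r -> nat) :=
  exists (T : smashModule A) (p : 'Hom(tensor M N, T)),
    tensor_over_A p /\ Gr_class X T c.

(* Row i holds the coordinates of [V][X i], resp. [X i][V].                   *)
Definition left_mul_mx (r : nat) (X : 'I_r -> smashModule A)
    (V : smashModule A) (L : 'M[nat]_r) :=
  forall i, Gr_mul X V (X i) (L i).

Definition right_mul_mx (r : nat) (X : 'I_r -> smashModule A)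
    (V : smashModule A) (L : 'M[nat]_r) :=
  forall i, Gr_mul X (X i) V (L i).

End MonoidalStructure.

(* Eigenvalues of an integer matrix are algebraic, and 0 < e in algC entails  *)
(* that e is real.                                                            *)
Definition largest_positive_eigenvalue (r : nat) (L : 'M[nat]_r) (d : algC) :=
  let LC := map_mx (fun n => n%:R : algC) L in
  [/\ eigenvalue LC d, 0 < d & forall e, eigenvalue LC e -> 0 < e -> e <= d].

(* [is_FPdim R V d] : the Frobenius-Perron dimension of V is d, computed with *)
(* the matrix of left as well as of right multiplication by [V].              *)
Definition is_FPdim (k : fieldType) (H : hopfAlgebra k) (R : tensor H H)
    (A : moduleAlgebra H) (V : smashModule A) (d : algC) :=
  exists (r : nat) (X : 'I_r -> smashModule A) (L L' : 'M[nat]_r),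
    [/\ simple_system X,
        left_mul_mx R X V L, right_mul_mx R X V L',
        largest_positive_eigenvalue L d & largest_positive_eigenvalue L' d].

(* Main.v *)
From HB Require Import structures.
From Stdlib Require Import Classical_Prop FunctionalExtensionality.
Require Import Defs.
From mathcomp Require Import all_boot all_order all_algebra all_field.

Set Implicit Arguments.
Unset Strict Implicit.
Unset Printing Implicit Defensive.

Import Order.TTheory GRing.Theory Num.Theory.
Local Open Scope ring_scope.

(** Everything rests on one formula, [tdim_mul]: for all modules M and N over
    A#H, writing (x) for the tensor product over A,
      dim (M (x) N) * dim A = dim M * dim N.
    Let X_1, ..., X_r be the simple modules.  By the formula, the positive
    vector (dim X_1, ..., dim X_r) is an eigenvector of the matrices of left and
    right multiplication by [V], with eigenvalue dim V / dim A.  An eigenvalue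
    of a nonnegative matrix that has a positive eigenvector is the largest
    positive one ([PF_largest]), so dim V / dim A is the Frobenius-Perron dimension; being a
    rational eigenvalue of an integer matrix, it is an integer
    ([eigenvalue_nat]), whence the divisibility.

    To prove the formula, fix M and consider the ratio dim (M (x) N) / dim N.
    - Choose X simple of maximal ratio.  Since M (x) - is right exact, its
      dimension is subadditive ([tdim_sum]), and every N is a sum of simple
      modules: the ratio of X bounds the ratio of every module
      ([exists_extremal]).
    - Let Y be the module of linear maps H -> X coinduced from the A-module X,
      in the form where A acts through its action on X.  As an A-module it is
      a direct sum of copies of X; so Y, and any power of Y, attains the
      maximal ratio ([tdim_coinduced]).
    - Every N embeds in a power of Y ([coinduced_embed]), and is a direct
      summand of it by Maschke's theorem ([inv_compl]).  The ratio of a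
      complement of N is at most the maximum, hence N attains it as well
      ([tdim_lower]).
    So the ratio does not depend on N, and N = A gives the value
    dim M / dim A.

    The embedding sends n to the family of maps
      h |-> S(h_1) . x^1 g(x^2 h_2 n),
    indexed by the linear maps g : N -> X, where x is the separability
    idempotent.  It is injective because a nonzero A#H-module is faithful over
    A: its annihilator in A is an H-stable ideal ([faithful], [sep_nondeg]).
    The idempotent x also splits the projection of the tensor product over k
    onto the one over A ([rel_proj]), and, combined with an integral of H, it
    averages linear maps into A#H-linear ones ([avg]). *)

(** * Linearity of formulas in Sweedler notation *)

Section Lin.
Context (k : fieldType).
Implicit Types U V W : lmodType k.

Lemma lin_Z U V (f : U -> V) : linear f -> forall c x, f (c *: x) = c *: f x.
Proof. exact: scalable_linear. Qed.

Lemma lin_id U : linear (fun x : U => x).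
Proof. by []. Qed.

Lemma lin_app U V W (g : {linear V -> W}) (f : U -> V) :
  linear f -> linear (fun x => g (f x)).
Proof. by move=> lf a u v; rewrite lf linearP. Qed.

Lemma lin_comp U V W (g : V -> W) (f : U -> V) :
  linear g -> linear f -> linear (fun x => g (f x)).
Proof. by move=> lg lf a u v; rewrite lf lg. Qed.

Lemma lin_scale_r U V (f : U -> V) c : linear f -> linear (fun x => c *: f x).
Proof. by move=> lf a u v; rewrite lf scalerDr !scalerA mulrC. Qed.

Lemma lin_scale_l U V (f : U -> k^o) (v : V) :
  linear f -> linear (fun x => (f x : k) *: v).
Proof. by move=> lf a x y; rewrite lf scalerDl scalerA. Qed.

Lemma lin_lfun U (V W : vectType k) (g : 'Hom(V, W)) (f : U -> V) :
  linear f -> linear (fun x => g (f x)).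
Proof. by move=> lf a u v; rewrite lf linearP. Qed.

Lemma lin_lfun_l U (V W : vectType k) (f : U -> 'Hom(V, W)) v :
  linear f -> linear (fun x => f x v).
Proof. by move=> lf a x y; rewrite lf add_lfunE scale_lfunE. Qed.

Lemma lin_comp_l U (V W X : vectType k) (f : U -> 'Hom(V, W)) (g : 'Hom(X, V)) :
  linear f -> linear (fun x => (f x \o g)%VF).
Proof. by move=> lf a x y; rewrite lf comp_lfunDl comp_lfunZl. Qed.

Lemma lin_comp_r U (V W X : vectType k) (f : 'Hom(V, W)) (g : U -> 'Hom(X, V)) :
  linear g -> linear (fun x => (f \o g x)%VF).
Proof. by move=> lf a x y; rewrite lf comp_lfunDr comp_lfunZr. Qed.

Lemma lin_mul_l U (B : falgType k) (f : U -> B) b :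
  linear f -> linear (fun x => f x * b).
Proof. by move=> lf a x y; rewrite lf mulrDl scalerAl. Qed.

Lemma lin_mul_r U (B : falgType k) (f : U -> B) b :
  linear f -> linear (fun x => b * f x).
Proof. by move=> lf a x y; rewrite lf mulrDr scalerAr. Qed.

Lemma lin_tens_l U (V W : vectType k) (f : U -> V) (w : W) :
  linear f -> linear (fun x => f x \ox w).
Proof.
move=> lf a x y; apply/matrixP => i j.
by rewrite !mxE lf linearP mulrDl mulrA.
Qed.

Lemma lin_tens_r U (V W : vectType k) (f : U -> W) (v : V) :
  linear f -> linear (fun x => v \ox f x).
Proof.
move=> lf a x y; apply/matrixP => i j.
by rewrite !mxE lf linearP mulrDr !mulrA (mulrC a).
Qed.

Lemma lin_sw_t U (V W : vectType k) (X : lmodType k) (f : U -> tensor V W) (F : V -> W -> X) :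
  linear f -> linear (fun x => sweedler (f x) F).
Proof.
move=> lf a x y; rewrite lf /sweedler scaler_sumr -big_split.
apply: eq_bigr => i _; rewrite scaler_sumr -big_split.
by apply: eq_bigr => j _; rewrite !mxE scalerDl scalerA.
Qed.

Lemma lin_sw U (V W : vectType k) (X : lmodType k) (t : tensor V W) (F : U -> V -> W -> X) :
  (forall y z, linear (fun x => F x y z)) ->
  linear (fun x => sweedler t (F x)).
Proof.
move=> lF a x y; rewrite /sweedler scaler_sumr -big_split.
apply: eq_bigr => i _; rewrite scaler_sumr -big_split.
apply: eq_bigr => j _.
by rewrite lF scalerDr !scalerA mulrC.
Qed.

Lemma lin_lmulA_l U (H : hopfAlgebra k) (A : moduleAlgebra H)
    (M : smashModule A) (f : U -> A) (m : M) :
  linear f -> linear (fun x => lmulA (f x) m).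
Proof. by move=> lf; apply/lin_lfun_l/lin_app/lin_tens_l. Qed.

Lemma lin_lmulA_r U (H : hopfAlgebra k) (A : moduleAlgebra H)
    (M : smashModule A) (f : U -> M) (a : A) :
  linear f -> linear (fun x => lmulA a (f x)).
Proof. by move=> lf; apply/lin_lfun. Qed.

Lemma lin_rmulA_l U (H : hopfAlgebra k) (R : tensor H H)
    (A : moduleAlgebra H) (M : smashModule A) (f : U -> M) (a : A) :
  linear f -> linear (fun x => rmulA R (f x) a).
Proof. by move=> lf; apply/lin_lfun. Qed.

Lemma lin_rmulA_r U (H : hopfAlgebra k) (R : tensor H H)
    (A : moduleAlgebra H) (M : smashModule A) (f : U -> A) (m : M) :
  linear f -> linear (fun x => rmulA R m (f x)).
Proof.
move=> lf; apply/lin_lfun_l/lin_app; apply: lin_sw => y z.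
exact/lin_tens_l/lin_lfun.
Qed.

Definition hact (H : hopfAlgebra k) (A : moduleAlgebra H)
    (M : smashModule A) (h : H) (m : M) : M := sact M ((1 : A) \ox h) m.

Lemma lin_hact_l U (H : hopfAlgebra k) (A : moduleAlgebra H)
    (M : smashModule A) (f : U -> H) (m : M) :
  linear f -> linear (fun x => hact (f x) m).
Proof. by move=> lf; apply/lin_lfun_l/lin_app/lin_tens_r. Qed.

Lemma lin_hact_r U (H : hopfAlgebra k) (A : moduleAlgebra H)
    (M : smashModule A) (f : U -> M) (h : H) :
  linear f -> linear (fun x => hact h (f x)).
Proof. by move=> lf; apply/lin_lfun. Qed.

End Lin.
Arguments lin_Z {k U V} f.

(** Each use of a Sweedler identity on a multilinear function leaves one goal
    [linear (fun x => ...)] per argument.  The tactic peels off the outermost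
    operation; an alternative whose constant operand would have to contain the
    bound variable fails to unify, so that the right operand is selected. *)
Ltac lin :=
  cbv beta;
  match goal with
  | |- forall _, _ => let x := fresh in intro x; lin
  | H : linear ?f |- linear ?f => exact H
  | _ =>
  first [ solve [auto 2 with nocore] | apply: lin_id
        | apply: lin_mul_l; lin | apply: lin_mul_r; lin
        | apply: lin_lmulA_l; lin | apply: lin_lmulA_r; lin
        | apply: lin_hact_l; lin | apply: lin_hact_r; lin
        | apply: lin_rmulA_l; lin | apply: lin_rmulA_r; lin
        | apply: lin_tens_l; lin | apply: lin_tens_r; lin
        | apply: lin_sw_t; lin | apply: lin_sw; lin
        | apply: lin_scale_l; lin | apply: lin_scale_r; lin
        | apply: lin_comp_l; lin | apply: lin_comp_r; lin
        | apply: lin_lfun_l; lin | apply: lin_lfun; lin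
        | apply: lin_app; lin ]
  end.

(** * Calculus with Sweedler sums *)

Section Sweedler.
Context (k : fieldType).
Implicit Types U V : vectType k.
Implicit Types W X : lmodType k.

Lemma eq_sw U V W (t : tensor U V) (f g : U -> V -> W) :
  (forall x y, f x y = g x y) -> sweedler t f = sweedler t g.
Proof.
by move=> fg; apply: eq_bigr => i _; apply: eq_bigr => j _; rewrite fg.
Qed.

Lemma sw_map U V W X (t : tensor U V) (f : U -> V -> W) (g : W -> X) :
  linear g -> g (sweedler t f) = \sw_(x, y <- t) g (f x y).
Proof.
move=> lg; pose gL := GRing.isLinear.Build _ _ _ _ g lg.
pose g' : {linear W -> X} := HB.pack g gL.
rewrite -[g]/(g' : W -> X) /sweedler linear_sum; apply: eq_bigr => i _.
by rewrite linear_sum; apply: eq_bigr => j _; rewrite linearZ.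
Qed.
Arguments sw_map {U V W X t f} g lg.

Lemma sw_exch U V U' V' W (s : tensor U V) (t : tensor U' V')
    (f : U -> V -> U' -> V' -> W) :
  \sw_(x, y <- s) \sw_(z, w <- t) f x y z w =
  \sw_(z, w <- t) \sw_(x, y <- s) f x y z w.
Proof.
rewrite /sweedler pair_big /= [RHS]pair_big /=.
under eq_bigr => p _ do rewrite pair_big /= scaler_sumr.
under [RHS]eq_bigr => p _ do rewrite pair_big /= scaler_sumr.
rewrite exchange_big /=; apply: eq_bigr => p _; apply: eq_bigr => q _.
by rewrite !scalerA mulrC.
Qed.

Lemma tensor_eta U V (t : tensor U V) : \sw_(x, y <- t) (x \ox y) = t.
Proof.
have E (w : vectType k) (i j : 'I_(\dim {:w})) :
  coord (vbasis {:w}) i (vbasis {:w})`_j = (i == j)%:R.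
  by rewrite coord_free 1?eq_sym //; apply: basis_free (vbasisP _).
apply/matrixP => i j; rewrite /sweedler summxE (bigD1 i) //= summxE (bigD1 j) //=.
rewrite !mxE !E // !eqxx !mulr1 big1 ?addr0 => [|j' nj]; last first.
  by rewrite !mxE !E // eq_sym (negbTE nj) !mulr0.
rewrite big1 ?addr0 // => i' ni; rewrite summxE big1 // => j' _.
by rewrite !mxE !E // eq_sym (negbTE ni) mul0r mulr0.
Qed.

Lemma tensor_ext U V W (f g : tensor U V -> W) :
  linear f -> linear g -> (forall x y, f (x \ox y) = g (x \ox y)) -> f =1 g.
Proof.
move=> lf lg fg t; rewrite -(tensor_eta t) !(sw_map _ _) //.
exact: eq_sw.
Qed.

End Sweedler.
Arguments sw_map {k U V W X t f} g lg.

Section Linfun.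
Context (k : fieldType).

Definition mk_lin (U V : lmodType k) (f : U -> V) (lf : linear f) :
  {linear U -> V} := HB.pack f (GRing.isLinear.Build _ _ _ _ f lf).

Definition lfun_of (U V : vectType k) (f : U -> V) (lf : linear f) :
  'Hom(U, V) := linfun (mk_lin lf).

Lemma lfun_ofE (U V : vectType k) (f : U -> V) (lf : linear f) x :
  lfun_of lf x = f x.
Proof. by rewrite /lfun_of lfunE. Qed.

Lemma bilin_subproof (U : lmodType k) (V W : vectType k) (f : U -> V -> W)
    (l1 : forall v, linear (f^~ v)) (l2 : forall u, linear (f u)) :
  linear (fun u => lfun_of (l2 u)).
Proof.
move=> a x y; apply/lfunP => v.
by rewrite add_lfunE scale_lfunE !lfun_ofE l1.
Qed.

Definition bilin_of (U : lmodType k) (V W : vectType k) (f : U -> V -> W)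
    (l1 : forall v, linear (f^~ v)) (l2 : forall u, linear (f u)) :
  {linear U -> 'Hom(V, W)} := mk_lin (bilin_subproof l1 l2).

Lemma bilin_ofE (U : lmodType k) (V W : vectType k) (f : U -> V -> W)
    (l1 : forall v, linear (f^~ v)) (l2 : forall u, linear (f u)) u v :
  bilin_of l1 l2 u v = f u v.
Proof. exact: lfun_ofE. Qed.

End Linfun.

(** * Identities in a Hopf algebra *)

Section Hopf.
Context (k : fieldType) (H : hopfAlgebra k).
Implicit Types (g h : H) (W : lmodType k).

(** The Hopf algebra axioms are equations between tensors.  Composing them with
    the linear map induced by a multilinear function gives the forms below,
    which rewrite under arbitrary contexts. *)
Lemma sw_Delta_assoc W h (f : H -> H -> H -> W) :
  (forall b z, linear (fun a => f a b z)) ->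
  (forall a z, linear (fun b => f a b z)) ->
  (forall a b, linear (f a b)) ->
  \sw_(x, z <- Delta h) \sw_(a, b <- Delta x) f a b z =
  \sw_(a, y <- Delta h) \sw_(b, z <- Delta y) f a b z.
Proof.
move=> l1 l2 l3.
pose F (t : tensor (tensor H H) H) := \sw_(s, z <- t) \sw_(a, b <- s) f a b z.
have lF : linear F by rewrite /F; lin.
have FE a b z : F ((a \ox b) \ox z) = f a b z.
  rewrite /F sweedler_tens; [| by lin | by lin].
  by rewrite sweedler_tens; [| by lin | by lin].
have := congr1 F (Delta_coassoc h).
rewrite !(sw_map _ lF) => E.
transitivity (\sw_(x, z <- Delta h)
   F (\sw_(a, b <- Delta x) ((a \ox b) \ox z))).
  by apply: eq_sw => x z; rewrite (sw_map _ lF); apply: eq_sw => a b.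
rewrite E; apply: eq_sw => a y; rewrite (sw_map _ lF).
by apply: eq_sw => b z.
Qed.

Lemma sw_counitl W h (f : H -> W) : linear f ->
  \sw_(x, y <- Delta h) (counit x *: f y) = f h.
Proof.
move=> lf; rewrite -[in RHS](Delta_counitl h) (sw_map _ lf).
by apply: eq_sw => x y; rewrite (scalable_linear lf).
Qed.
Arguments sw_counitl {W h} f.

Lemma sw_counitr W h (f : H -> W) : linear f ->
  \sw_(x, y <- Delta h) (counit y *: f x) = f h.
Proof.
move=> lf; rewrite -[in RHS](Delta_counitr h) (sw_map _ lf).
by apply: eq_sw => x y; rewrite (scalable_linear lf).
Qed.
Arguments sw_counitr {W h} f.

Lemma sw_antipodel W h (f : H -> W) : linear f ->
  \sw_(x, y <- Delta h) f (antipode x * y) = counit h *: f 1.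
Proof.
by move=> lf; rewrite -(scalable_linear lf) -antipodel (sw_map _ lf).
Qed.
Arguments sw_antipodel {W} h f.

Lemma sw_antipoder W h (f : H -> W) : linear f ->
  \sw_(x, y <- Delta h) f (x * antipode y) = counit h *: f 1.
Proof.
by move=> lf; rewrite -(scalable_linear lf) -antipoder (sw_map _ lf).
Qed.
Arguments sw_antipoder {W} h f.

Lemma sw_DeltaM W g h (f : H -> H -> W) :
  (forall b, linear (f^~ b)) -> (forall a, linear (f a)) ->
  \sw_(x, y <- Delta (g * h)) f x y =
  \sw_(a, b <- Delta g) \sw_(c, d <- Delta h) f (a * c) (b * d).
Proof.
move=> l1 l2; rewrite DeltaM /tensor_mul.
pose F (t : tensor H H) := \sw_(x, y <- t) f x y.
have lF : linear F by rewrite /F; lin.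
rewrite -[LHS]/(F _) (sw_map _ lF); apply: eq_sw => a b.
rewrite (sw_map _ lF); apply: eq_sw => c d.
by rewrite /F sweedler_tens.
Qed.
Arguments sw_DeltaM {W} g h f.

Lemma sw_Delta1 W (f : H -> H -> W) :
  (forall b, linear (f^~ b)) -> (forall a, linear (f a)) ->
  \sw_(x, y <- Delta 1) f x y = f 1 1.
Proof. by move=> l1 l2; rewrite Delta1 sweedler_tens. Qed.
Arguments sw_Delta1 {W} f.

(** Both sides are convolution inverses of the multiplication H (x) H -> H:
    each equals S(h_1) S(g_1) g_2 h_2 S(g_3 h_3). *)
Lemma antipodeM g h : antipode (g * h) = antipode h * antipode g :> H.
Proof.
transitivity (\sw_(a, x <- Delta g) \sw_(b, y <- Delta h)
   (antipode b * antipode a * (\sw_(u, v <- Delta (x * y)) (u * antipode v)))).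
  transitivity (\sw_(a, x <- Delta g) \sw_(b, y <- Delta h)
    \sw_(c, u <- Delta x) \sw_(d, v <- Delta y)
     (antipode b * (antipode a * c) * d * antipode (u * v))); last first.
    apply: eq_sw => a x; apply: eq_sw => b y.
    rewrite (sw_DeltaM _ _ (fun u v => u * antipode v)); [| by lin | by lin].
    rewrite (sw_map (fun z => antipode b * antipode a * z)); last by lin.
    apply: eq_sw => c d.
    rewrite (sw_map (fun z => antipode b * antipode a * z)); last by lin.
    by apply: eq_sw => u v; rewrite !mulrA.
  have E a x b y : \sw_(c, u <- Delta x) \sw_(d, v <- Delta y)
     (antipode b * (antipode a * c) * d * antipode (u * v)) = 
     \sw_(d, v <- Delta y) \sw_(c, u <- Delta x)
     (antipode b * (antipode a * c) * d * antipode (u * v)) :> H.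
    by rewrite sw_exch.
  transitivity (\sw_(a, x <- Delta g) \sw_(b, y <- Delta h)
     \sw_(d, v <- Delta y) \sw_(c, u <- Delta x)
     (antipode b * (antipode a * c) * d * antipode (u * v)) : H); last first.
    by apply: eq_sw => a x; apply: eq_sw => b y; rewrite E.
  rewrite sw_exch.
  (* Cancelling S(g_1) g_2, and then S(h_1) h_2, leaves S(gh). *)
  transitivity (\sw_(b, y <- Delta h) \sw_(d, v <- Delta y)
     (antipode b * d * antipode (g * v)) : H).
    rewrite -sw_Delta_assoc; try by lin.
    transitivity (\sw_(x, y <- Delta h) (counit x *: antipode (g * y) : H)).
      by rewrite (sw_counitl (fun y => antipode (g * y))) //; lin.
    apply: eq_sw => x y.
    rewrite (sw_antipodel _ (fun z => z * antipode (g * y))); last by lin.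
    by rewrite mul1r.
  apply: eq_sw => b y; rewrite sw_exch; apply: eq_sw => d v.
  rewrite -sw_Delta_assoc; try by lin.
  transitivity (\sw_(x, y <- Delta g) (counit x *: (antipode b * d * antipode (y * v))) : H).
    by rewrite (sw_counitl (fun y => antipode b * d * antipode (y * v))) //; lin.
  apply: eq_sw => x z.
  rewrite (sw_antipodel _ (fun w => antipode b * w * d * antipode (z * v))); last by lin.
  by rewrite mulr1.
(* Cancelling g_2 h_2 S(g_3 h_3) instead leaves S(h) S(g). *)
transitivity (\sw_(a, x <- Delta g) \sw_(b, y <- Delta h)
   (counit x *: (counit y *: (antipode b * antipode a)) : H)).
  apply: eq_sw => a x; apply: eq_sw => b y.
  by rewrite antipoder counitM -scalerAr mulr1 scalerA.
transitivity (\sw_(a, x <- Delta g) (counit x *: (antipode h * antipode a)) : H).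
  apply: eq_sw => a x.
  rewrite -(sw_counitr (fun b => antipode b * antipode a)); last by lin.
  by rewrite (sw_map (fun w : H => counit x *: w)) //; lin.
by rewrite (sw_counitr (fun a => antipode h * antipode a)) //; lin.
Qed.

Lemma antipode1 : antipode 1 = 1 :> H.
Proof.
have := antipodel (1 : H).
rewrite (sw_Delta1 (fun x y => antipode x * y)); [|by lin|by lin].
by rewrite mulr1 counit1 scale1r.
Qed.

End Hopf.
Arguments sw_counitl {k H W h} f.
Arguments sw_counitr {k H W h} f.
Arguments sw_antipodel {k H W} h f.
Arguments sw_antipoder {k H W} h f.
Arguments sw_DeltaM {k H W} g h f.
Arguments sw_Delta1 {k H W} f.

(** * The integral of a semisimple Hopf algebra *)

(** Simple summands are added to [J'] one at a time; each of them either meets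
    J + J' trivially or lies inside it. *)
Lemma left_ideal_compl (k : fieldType) (B : falgType k) (J : {vspace B}) :
  semisimple_algebra B -> left_ideal J ->
  exists J' : {vspace B},
    [/\ left_ideal J', (J :&: J' = 0)%VS & (J + J' = fullv)%VS].
Proof.
move=> [n [I [Isimple _ Ifull]]] Jideal.
have addI (U V : {vspace B}) : left_ideal U -> left_ideal V -> left_ideal (U + V).
  move=> iU iV b _ /memv_addP[u uU [v vV ->]].
  by rewrite mulrDr memv_add ?iU ?iV.
suff [J' [iJ' JJ' sJ']] : exists J' : {vspace B},
    [/\ left_ideal J', (J :&: J' = 0)%VS
      & forall i, i \in enum 'I_n -> (I i <= J + J')%VS].
  exists J'; split=> //; apply/eqP; rewrite eqEsubv subvf -Ifull.
  by apply/subv_sumP => i _; apply: sJ'; rewrite mem_enum.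
elim: (enum 'I_n) => [|i s [J' [iJ' JJ' sJ']]].
  exists 0%VS; split=> //; first by move=> b x; rewrite memv0 => /eqP->; rewrite mulr0 mem0v.
  by rewrite capv0.
have [iI _ /(_ (I i :&: (J + J'))%VS)] := Isimple i.
case=> [b x||E0|E1].
- by rewrite !memv_cap => /andP[xI xJ]; rewrite iI // addI.
- exact: capvSl.
- exists (J' + I i)%VS; split; first exact: addI.
    apply/eqP; rewrite -subv0; apply/subvP => x; rewrite memv_cap.
    case/andP => xJ /memv_addP[u uJ' [v vI xE]].
    have v0 : v = 0.
      apply/eqP; rewrite -memv0 -E0 memv_cap vI /=.
      have -> : v = x - u by rewrite xE addrC addKr.
      by rewrite memv_add ?memvN.
    by rewrite -JJ' memv_cap xJ xE v0 addr0.
  move=> j; rewrite inE => /predU1P[->|/sJ' sj]; first by rewrite addvA addvSr.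
  by rewrite (subv_trans sj) // addvA addvSl.
- exists J'; split=> // j; rewrite inE => /predU1P[->|/sJ' //].
  by rewrite -E1 capvSr.
Qed.

(** A complement of the augmentation ideal is spanned by a left integral t.  It
    is also a right integral: the elements of tH are left integrals, those of
    counit 0 form a left ideal of square zero, which vanishes by semisimplicity,
    and t h - counit(h) t is one of them. *)
Lemma exists_integral (k : fieldType) (H : hopfAlgebra k) :
  semisimple_algebra H ->
  exists t : H, [/\ counit t = 1, forall h, h * t = counit h *: t
                  & forall h, t * h = counit h *: t].
Proof.
move=> Hss; pose K := lker (linfun (@counit k H)).
have inK x : (x \in K) = (counit x == 0) by rewrite memv_ker lfunE.
have iK : left_ideal K by move=> b x; rewrite !inK counitM => /eqP->; rewrite mulr0.
have [I [iI KI KIf]] := left_ideal_compl Hss iK.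
have /memv_addP[e eK [t tI E1]] : (1 : H) \in (K + I)%VS by rewrite KIf memvf.
have et : counit t = 1.
  have := counit1 H; rewrite E1 linearD /=.
  by move: eK; rewrite inK => /eqP->; rewrite add0r.
have lt h : h * t = counit h *: t.
  apply/eqP; rewrite -subr_eq0 -memv0 -KI memv_cap inK.
  rewrite linearB linearZ /= counitM et mulr1 [_ *: 1]mulr1 subrr eqxx /=.
  by rewrite memvB ?iI ?memvZ.
exists t; split=> // h.
pose J := (limg (amull t) :&: K)%VS.
have inJ x : x \in J -> (forall g, g * x = counit g *: x) /\ counit x = 0.
  rewrite memv_cap inK => /andP[/memv_imgP[y _ ->] /eqP->]; split=> // g.
  by rewrite lfunE /= mulrA lt scalerAl.
have iJ : left_ideal J.
  by move=> b x xJ; have [-> _] := inJ _ xJ; apply: memvZ.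
have [J' [iJ' JJ' JJf]] := left_ideal_compl Hss iJ.
have /memv_addP[j jJ [j' jJ' E]] : (1 : H) \in (J + J')%VS by rewrite JJf memvf.
have J0 x : x \in J -> x = 0.
  move=> xJ; apply/eqP; rewrite -memv0 -JJ' memv_cap xJ /=.
  rewrite -[x]mulr1 E mulrDr; have [-> _] := inJ _ jJ; have [_ ->] := inJ _ xJ.
  by rewrite scale0r add0r iJ'.
apply/eqP; rewrite -subr_eq0; apply/eqP/J0.
rewrite memv_cap inK; apply/andP; split.
  have -> : t * h - counit h *: t = amull t (h - counit h *: 1).
    by rewrite lfunE /= mulrBr -scalerAr mulr1.
  exact: memv_img (memvf _).
by rewrite linearB linearZ /= counitM et mul1r [_ *: 1]mulr1 subrr.
Qed.

(** * Modules over the smash product *)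

Section Smash.
Context (k : fieldType) (H : hopfAlgebra k) (A : moduleAlgebra H).
Implicit Types (g h : H) (a b : A).

Lemma smash_mul_tens a h b g :
  smash_mul (a \ox h) (b \ox g) =
  \sw_(h1, h2 <- Delta h) ((a * act h1 b) \ox (h2 * g)).
Proof.
rewrite /smash_mul sweedler_tens; [| by lin | by lin].
by rewrite sweedler_tens; [| by lin | by lin].
Qed.

Section Module.
Variable M : smashModule A.
Implicit Types (m : M).

Lemma sact_tens a h m : sact M (a \ox h) m = lmulA a (hact h m).
Proof.
rewrite /lmulA /hact -sactM smash_mul_tens.
rewrite (sw_Delta1 (fun x y => (a * act x 1) \ox (y * h))); [|by lin|by lin].
by rewrite act1 mulr1 mul1r.
Qed.

Lemma sactE s m : sact M s m = \sw_(a, h <- s) lmulA a (hact h m).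
Proof.
rewrite -{1}(tensor_eta s) (sw_map (fun s => sact M s m)); last by lin.
by apply: eq_sw => a h; rewrite sact_tens.
Qed.

Lemma lmulA1 m : lmulA (1 : A) m = m.
Proof. exact: sact1. Qed.

Lemma hact1 m : hact (1 : H) m = m.
Proof. exact: sact1. Qed.

Lemma lmulAM a b m : lmulA (a * b) m = lmulA a (lmulA b m).
Proof.
rewrite /lmulA -sactM smash_mul_tens.
rewrite (sw_Delta1 (fun x y => (a * act x b) \ox (y * 1))); [|by lin|by lin].
by rewrite act1 mulr1.
Qed.

Lemma hactM g h m : hact (g * h) m = hact g (hact h m).
Proof.
rewrite /hact -sactM smash_mul_tens (sw_map (fun s => sact M s m)); last by lin.
rewrite -[in LHS](sw_counitl (fun x => sact M (1 \ox (x * h)) m)); last by lin.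
apply: eq_sw => x y.
by rewrite act_unit mul1r (scalable_linear (lin_tens_l _ (@lin_id _ A)))
  linearZ scale_lfunE.
Qed.

Lemma hact_lmulA h a m :
  hact h (lmulA a m) = \sw_(h1, h2 <- Delta h) lmulA (act h1 a) (hact h2 m).
Proof.
rewrite {1}/hact {1}/lmulA -sactM smash_mul_tens.
rewrite (sw_map (fun s => sact M s m)); last by lin.
by apply: eq_sw => x y; rewrite mul1r mulr1 sact_tens.
Qed.

Lemma lmulA_act h a m :
  lmulA (act h a) m =
  \sw_(h1, h2 <- Delta h) hact h1 (lmulA a (hact (antipode h2) m)).
Proof.
transitivity (\sw_(x, y <- Delta h) \sw_(b, c <- Delta x)
   lmulA (act b a) (hact (c * antipode y) m)); last first.
  apply: eq_sw => x y; rewrite hact_lmulA; apply: eq_sw => b c.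
  by rewrite hactM.
rewrite sw_Delta_assoc; try by lin.
rewrite -(sw_counitr (fun x => lmulA (act x a) m)); last by lin.
apply: eq_sw => x y.
rewrite (sw_antipoder _ (fun y => lmulA (act x a) (hact y m))); last by lin.
by rewrite hact1.
Qed.

(** Expand h_2.a as h_2 a S(h_3) and cancel S(h_1) h_2.  In this form the
    antipode moves past [a] without the appearance of its inverse. *)
Lemma antipode_lmulA h a m :
  lmulA a (hact (antipode h) m) =
  \sw_(h1, h2 <- Delta h) hact (antipode h1) (lmulA (act h2 a) m).
Proof.
transitivity (\sw_(x, y <- Delta h) \sw_(b, c <- Delta y)
   hact (antipode x * b) (lmulA a (hact (antipode c) m))); last first.
  apply: eq_sw => x y; rewrite lmulA_act.
  rewrite (sw_map (fun m => hact (antipode x) m)); last by lin.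
  by apply: eq_sw => b c; rewrite hactM.
rewrite -sw_Delta_assoc; try by lin.
rewrite -(sw_counitl (fun x => lmulA a (hact (antipode x) m))); last by lin.
apply: eq_sw => x y.
rewrite (sw_antipodel _ (fun z => hact z (lmulA a (hact (antipode y) m)))); last by lin.
by rewrite hact1.
Qed.

End Module.

(** A module over A#H is a vector space with an action of A and an action of H
    related by h (a v) = (h_1.a) (h_2 v); the modules constructed below are
    given in this form. *)
Section Build.
Context (V : vectType k) (l : A -> V -> V) (r : H -> V -> V).
Hypothesis ll1 : forall v, linear (l^~ v).
Hypothesis ll2 : forall a, linear (l a).
Hypothesis lr1 : forall v, linear (r^~ v).
Hypothesis lr2 : forall h, linear (r h).
Hypothesis l1 : forall v, l 1 v = v.
Hypothesis lM : forall a b v, l (a * b) v = l a (l b v).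
Hypothesis r1 : forall v, r 1 v = v.
Hypothesis rM : forall g h v, r (g * h) v = r g (r h v).
Hypothesis rl : forall h a v,
  r h (l a v) = \sw_(x, y <- Delta h) l (act x a) (r y v).

Definition build_sact (s : tensor A H) (v : V) : V :=
  \sw_(a, h <- s) l a (r h v).

Lemma build_sact_lin1 v : linear (build_sact^~ v).
Proof. by rewrite /build_sact; lin. Qed.

Lemma build_sact_lin2 s : linear (build_sact s).
Proof.
rewrite /build_sact; apply: lin_sw => a h.
exact: (lin_comp (ll2 a) (lr2 h)).
Qed.

Lemma build_sact_tens a h v : build_sact (a \ox h) v = l a (r h v).
Proof.
rewrite /build_sact sweedler_tens // => x.
exact: (lin_comp (ll2 _) (lr1 _)).
Qed.

Definition buildF := bilin_of build_sact_lin1 build_sact_lin2.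

Lemma build_sact1 v : buildF (1 \ox 1) v = v.
Proof. by rewrite bilin_ofE build_sact_tens r1 l1. Qed.

Lemma build_sactM s t v : buildF (smash_mul s t) v = buildF s (buildF t v).
Proof.
rewrite !bilin_ofE /smash_mul (sw_map _ (build_sact_lin1 v)).
rewrite [RHS]/build_sact; apply: eq_sw => a h.
rewrite (sw_map _ (build_sact_lin1 v)) {2}/build_sact.
rewrite (sw_map (r h)) // (sw_map (l a)) //; apply: eq_sw => b g.
rewrite (sw_map _ (build_sact_lin1 v)) rl (sw_map (l a)) //.
by apply: eq_sw => x y; rewrite build_sact_tens rM lM.
Qed.

Definition build_smash : smashModule A :=
  SmashModule build_sact1 build_sactM.

Lemma build_lmulA a (v : build_smash) : lmulA a v = l a v.
Proof. by rewrite -[LHS]/(buildF _ _) bilin_ofE build_sact_tens r1. Qed.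

Lemma build_hact h (v : build_smash) : hact h v = r h v.
Proof. by rewrite -[LHS]/(buildF _ _) bilin_ofE build_sact_tens l1. Qed.

End Build.

Definition invariant (M : smashModule A) (U : {vspace M}) :=
  forall s m, m \in U -> sact M s m \in U.

Lemma smash_homP (M N : smashModule A) (f : 'Hom(M, N)) :
  (forall a m, f (lmulA a m) = lmulA a (f m)) ->
  (forall h m, f (hact h m) = hact h (f m)) -> smash_hom f.
Proof.
move=> fl fh s m; rewrite !sactE (sw_map f); last by lin.
by apply: eq_sw => a h; rewrite fl fh.
Qed.

End Smash.

(** * Averaging of linear maps *)

Section Hom.
Context (k : fieldType) (H : hopfAlgebra k) (A : moduleAlgebra H).
Implicit Types (g h : H) (a b : A).

(** The relation c_1 S((h c_2)_1) (x) (h c_2)_2 = S(h_1) (x) h_2 c makes both the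
    average over an integral and the coinduction map H-linear. *)
Lemma hact_antipode_shift (M : smashModule A) (K : H -> M) h c : linear K ->
  \sw_(u, v <- Delta c)
    hact u (\sw_(y, z <- Delta (h * v)) hact (antipode y) (K z)) =
  \sw_(y, z <- Delta h) hact (antipode y) (K (z * c)).
Proof.
move=> lK.
have lKr z : linear (fun v => K (z * v)) by apply: (lin_comp lK); lin.
have lKl v : linear (fun z => K (z * v)) by apply: (lin_comp lK); lin.
transitivity (\sw_(y, z <- Delta h) \sw_(u, v <- Delta c) \sw_(p, q <- Delta v)
   hact (u * antipode p) (hact (antipode y) (K (z * q)))).
  rewrite sw_exch; apply: eq_sw => u v.
  rewrite (sw_DeltaM h v (fun y z => hact (antipode y) (K z))); [|by lin|by lin].
  rewrite (sw_map (hact u)); last by lin.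
  apply: eq_sw => y z; rewrite (sw_map (hact u)); last by lin.
  by apply: eq_sw => p q; rewrite antipodeM !hactM.
apply: eq_sw => y z.
rewrite -sw_Delta_assoc; try by lin.
rewrite -(sw_counitl (fun q => hact (antipode y) (K (z * q)))); last by lin.
apply: eq_sw => w q.
rewrite (sw_antipoder _ (fun w => hact w (hact (antipode y) (K (z * q))))); last by lin.
by rewrite hact1.
Qed.

Section Sep.
Variable x : tensor A A.
Hypothesis xC : forall a, \sw_(x1, x2 <- x) ((a * x1) \ox x2) =
                          \sw_(x1, x2 <- x) (x1 \ox (x2 * a)).
Hypothesis xM1 : \sw_(x1, x2 <- x) (x1 * x2) = 1.

Lemma sw_sepC (W : lmodType k) (f : A -> A -> W) (c : A) :
  (forall b, linear (f^~ b)) -> (forall a, linear (f a)) ->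
  \sw_(a, b <- x) f (c * a) b = \sw_(a, b <- x) f a (b * c).
Proof.
move=> l1 l2; pose F (t : tensor A A) := \sw_(a, b <- t) f a b.
have lF : linear F by rewrite /F; lin.
have := congr1 F (xC c); rewrite !(sw_map _ lF) => E.
transitivity (\sw_(a, b <- x) F ((c * a) \ox b)).
  by apply: eq_sw => a b; rewrite /F sweedler_tens.
by rewrite E; apply: eq_sw => a b; rewrite /F sweedler_tens.
Qed.

Lemma sw_sep1 (W : lmodType k) (f : A -> W) : linear f ->
  \sw_(a, b <- x) f (a * b) = f 1.
Proof. by move=> lf; rewrite -[in RHS]xM1 (sw_map _ lf). Qed.

Variables M N : smashModule A.

(** The idempotent turns any linear map into an A-linear one. *)
Definition sep_fun (f : 'Hom(M, N)) (m : M) : N :=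
  \sw_(a, b <- x) lmulA a (f (lmulA b m)).

Lemma sep_fun_lin1 m : linear (sep_fun^~ m). Proof. by rewrite /sep_fun; lin. Qed.
Lemma sep_fun_lin2 f : linear (sep_fun f). Proof. by rewrite /sep_fun; lin. Qed.

Lemma sep_fun_lmulA f a m : sep_fun f (lmulA a m) = lmulA a (sep_fun f m).
Proof.
rewrite /sep_fun (sw_map (lmulA a)); last by lin.
transitivity (\sw_(x1, x2 <- x) lmulA x1 (f (lmulA (x2 * a) m))).
  by apply: eq_sw => b c; rewrite lmulAM.
rewrite -(@sw_sepC _ (fun b c => lmulA b (f (lmulA c m)))); try by lin.
by apply: eq_sw => b c; rewrite lmulAM.
Qed.

Variable t : H.
Hypothesis tR : forall h, t * h = counit h *: t.

(** H-linearization of [sep_fun f] for an integral t, written with S(t_1) on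
    the outside so that [antipode_lmulA] preserves A-linearity. *)
Definition avg_fun (f : 'Hom(M, N)) (m : M) : N :=
  \sw_(y, z <- Delta t) hact (antipode y) (sep_fun f (hact z m)).

Lemma avg_fun_lin f : linear (avg_fun f).
Proof. by rewrite /avg_fun /sep_fun; lin. Qed.

Definition avg (f : 'Hom(M, N)) : 'Hom(M, N) := lfun_of (avg_fun_lin f).

Lemma avg_hom f : smash_hom (avg f).
Proof.
apply: smash_homP => [a m|h m]; rewrite !lfun_ofE /avg_fun.
  transitivity (\sw_(y, z <- Delta t) \sw_(u, v <- Delta z)
      hact (antipode y) (lmulA (act u a) (sep_fun f (hact v m)))).
    apply: eq_sw => y z; rewrite hact_lmulA (sw_map (sep_fun f)); last exact: sep_fun_lin2.
    rewrite (sw_map (hact (antipode y))); last by lin.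
    by apply: eq_sw => u v; rewrite sep_fun_lmulA.
  rewrite /sep_fun -sw_Delta_assoc; try by lin.
  rewrite (sw_map (lmulA a)); last by lin.
  by apply: eq_sw => y z; rewrite antipode_lmulA.
transitivity (\sw_(y, z <- Delta t) hact (antipode y) (sep_fun f (hact (z * h) m))).
  by apply: eq_sw => y z; rewrite hactM.
rewrite -(@hact_antipode_shift _ (fun z => sep_fun f (hact z m))); last first.
  by rewrite /sep_fun; lin.
rewrite -[in RHS](sw_counitr (fun h => hact h (\sw_(y, z <- Delta t)
   hact (antipode y) (sep_fun f (hact z m))))); last by lin.
apply: eq_sw => u v; rewrite tR.
pose F s := hact u (\sw_(y, z <- s) hact (antipode y) (sep_fun f (hact z m))).
have lF : linear F by rewrite /F; lin.
by rewrite linearZ /=; apply: (scalable_linear lF).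
Qed.

End Sep.

Lemma hom_hact (M N : smashModule A) (f : 'Hom(M, N)) h m :
  smash_hom f -> f (hact h m) = hact h (f m).
Proof. exact. Qed.

Lemma hom_lmulA (M N : smashModule A) (f : 'Hom(M, N)) a m :
  smash_hom f -> f (lmulA a m) = lmulA a (f m).
Proof. exact. Qed.

(** The averaging is the identity where the map is already A#H-linear, here
    along a morphism [phi]; this serves both for projections onto submodules
    and for retractions of embeddings. *)
Lemma avg_factor (x : tensor A A) (t : H) (P M N : smashModule A)
    (phi : 'Hom(P, M)) (psi : 'Hom(P, N)) (f : 'Hom(M, N)) :
  \sw_(x1, x2 <- x) (x1 * x2) = 1 -> counit t = 1 ->
  smash_hom phi -> smash_hom psi ->
  (forall p, f (phi p) = psi p) -> forall p, avg x t f (phi p) = psi p.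
Proof.
move=> xM1 t1 hphi hpsi fg p; rewrite lfun_ofE /avg_fun.
transitivity (\sw_(y, z <- Delta t) hact (antipode y * z) (psi p)).
  apply: eq_sw => y z; rewrite hactM -(hom_hact _ _ hpsi) -(hom_hact _ _ hphi).
  congr (hact _ _); rewrite -[in RHS](lmulA1 (hact z p)).
  rewrite -(sw_sep1 xM1 (f := fun a => psi (lmulA a (hact z p)))); last by lin.
  apply: eq_sw => a b; rewrite lmulAM (hom_lmulA _ _ hpsi).
  by rewrite -(hom_lmulA _ _ hphi) fg.
rewrite (sw_antipodel _ (fun h => hact h (psi p))); last by lin.
by rewrite t1 scale1r hact1.
Qed.



(** * Morphisms, submodules and faithfulness *)

Lemma id_hom (M : smashModule A) : smash_hom (\1%VF : 'Hom(M, M)).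
Proof. by move=> s m; rewrite !id_lfunE. Qed.

Lemma comp_hom (M N P : smashModule A) (f : 'Hom(N, P)) (g : 'Hom(M, N)) :
  smash_hom f -> smash_hom g -> smash_hom (f \o g)%VF.
Proof. by move=> hf hg s m; rewrite !comp_lfunE hg hf. Qed.

Lemma lker_invariant (M N : smashModule A) (f : 'Hom(M, N)) :
  smash_hom f -> invariant (lker f).
Proof. by move=> hf s m; rewrite !memv_ker hf => /eqP->; rewrite linear0. Qed.

Lemma limg_invariant (M N : smashModule A) (f : 'Hom(M, N)) :
  smash_hom f -> invariant (limg f).
Proof.
by move=> hf s _ /memv_imgP[m _ ->]; rewrite -hf memv_img ?memvf.
Qed.

(** The action of M compressed to V through i : V -> M and p : M -> V.  The
    condition [pM] holds for the inclusion of a submodule and for the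
    projection onto a quotient module split by a linear section. *)
Section Transport.
Context (M : smashModule A) (V : vectType k).
Context (i : 'Hom(V, M)) (p : 'Hom(M, V)).
Hypothesis pi : forall v, p (i v) = v.
Hypothesis pM : forall s t v,
  p (sact M s (i (p (sact M t (i v))))) = p (sact M s (sact M t (i v))).

Definition transport_fun (s : tensor A H) (v : V) : V := p (sact M s (i v)).

Lemma transport_lin1 v : linear (transport_fun^~ v).
Proof. by rewrite /transport_fun; lin. Qed.
Lemma transport_lin2 s : linear (transport_fun s).
Proof. by rewrite /transport_fun; lin. Qed.

Lemma transport1 v : bilin_of transport_lin1 transport_lin2 (1 \ox 1) v = v.
Proof. by rewrite bilin_ofE /transport_fun sact1 pi. Qed.

Lemma transportM s t v : bilin_of transport_lin1 transport_lin2 (smash_mul s t) v =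
   bilin_of transport_lin1 transport_lin2 s (bilin_of transport_lin1 transport_lin2 t v).
Proof. by rewrite !bilin_ofE /transport_fun sactM pM. Qed.

Definition transport : smashModule A := SmashModule transport1 transportM.

Lemma transportE s v : sact transport s v = p (sact M s (i v)).
Proof. exact: bilin_ofE. Qed.

End Transport.

Section Sub.
Variables (M : smashModule A) (U : {vspace M}).
Hypothesis iU : invariant U.

Let incl : 'Hom(subvs_of U, M) := linfun vsval.
Let proj : 'Hom(M, subvs_of U) := linfun (vsproj U).

Lemma sub_pi v : proj (incl v) = v.
Proof. by rewrite !lfunE /= vsvalK. Qed.

Lemma sub_pM s t v : proj (sact M s (incl (proj (sact M t (incl v))))) =
  proj (sact M s (sact M t (incl v))).
Proof.
congr (proj (sact M s _)); rewrite !lfunE /= vsprojK //.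
by apply: iU; apply: subvsP.
Qed.

Definition sub_smash : smashModule A := transport sub_pi sub_pM.

Definition sub_incl : 'Hom(sub_smash, M) := incl.

Lemma sub_incl_hom : smash_hom sub_incl.
Proof.
move=> s m; rewrite /sub_incl transportE !lfunE /= vsprojK ?lfunE //.
by apply: iU; apply: subvsP.
Qed.

Lemma sub_incl_inj : injective sub_incl.
Proof. by move=> u v; rewrite !lfunE /= => /val_inj. Qed.

Lemma limg_sub_incl : limg sub_incl = U.
Proof.
apply/vspaceP => m; apply/memv_imgP/idP => [[v _ ->]|mU].
  by rewrite lfunE /= subvsP.
by exists (vsproj U m); rewrite ?memvf // lfunE /= vsprojK.
Qed.

Lemma sub_incl_in v : sub_incl v \in U.
Proof. by rewrite lfunE subvsP. Qed.

Lemma dim_sub_smash : \dim {:sub_smash} = \dim U.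
Proof. by rewrite dimvf. Qed.

End Sub.

Lemma lmulA0 (M : smashModule A) a : lmulA a (0 : M) = 0.
Proof. exact: linear0. Qed.

Lemma hact0 (M : smashModule A) h : hact h (0 : M) = 0.
Proof. exact: linear0. Qed.

(** The annihilator of U in A is a two-sided ideal, and an H-stable one since
    h.a acts as h_1 a S(h_2). *)
Lemma faithful (M : smashModule A) (U : {vspace M}) a : H_simple A ->
  invariant U -> U <> 0%VS -> (forall m, m \in U -> lmulA a m = 0) -> a = 0.
Proof.
move=> Asimple iU U0 aU.
pose F (a : A) := (sact M (a \ox 1%R) \o projv U)%VF.
have lF : linear F by rewrite /F; lin.
pose I := lker (lfun_of lF).
have inI b : (b \in I) <-> (forall m, m \in U -> lmulA b m = 0).
  rewrite memv_ker lfun_ofE; split=> [/eqP E m mU|E].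
    have := congr1 (fun f => fun_of_lfun f m) E.
    by rewrite comp_lfunE projv_id // zero_lfunE.
  by apply/eqP/lfunP => m; rewrite comp_lfunE zero_lfunE; apply: E; apply: memv_proj.
have [b c y /inI E||I0|I1] := Asimple I.
- by apply/inI => m mU; rewrite !lmulAM E ?lmulA0 //; apply: iU.
- move=> h y /inI E; apply/inI => m mU; rewrite lmulA_act.
  transitivity (\sw_(h1, h2 <- Delta h) (0 : M)).
    apply: eq_sw => h1 h2; rewrite E ?hact0 //.
    by apply: iU.
  by rewrite /sweedler !big1 // => i _; rewrite big1 // => j _; rewrite scaler0.
- by apply/eqP; rewrite -memv0 -I0; apply/inI.
- case: U0; apply/eqP; rewrite -subv0; apply/subvP => m mU.
  have /inI/(_ m mU) : (1 : A) \in I by rewrite I1 memvf.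
  by rewrite lmulA1 => ->; apply: mem0v.
Qed.

(** The unit object of the monoidal category. *)
Definition unit_smash : smashModule A :=
  @build_smash _ _ A A (fun a b => a * b) (fun h b => act h b)
   (fun v => ltac:(lin)) (fun a => ltac:(lin)) (fun v => ltac:(lin)) (fun h => ltac:(lin))
   (@mul1r _) (fun a b v => esym (mulrA a b v)) (@act1 _ _ A) (@actM _ _ A) (@act_mul _ _ A).

(** * Coinduced modules *)

(** Linear maps from a right H-module E to X, that is X tensored with the dual
    of E and the diagonal action of H.  Here A acts pointwise, so over A this
    is a direct sum of copies of X. *)
Section CoHom.
Context (X : smashModule A) (E : vectType k) (ra : E -> H -> E).
Hypothesis ra_l : forall h, linear (ra^~ h).
Hypothesis ra_r : forall e, linear (ra e).
Hypothesis ra1 : forall e, ra e 1 = e.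
Hypothesis raM : forall e g h, ra e (g * h) = ra (ra e g) h.

Definition coHom_l (a : A) (F : 'Hom(E, X)) : 'Hom(E, X) :=
  (sact X (a \ox 1%R) \o F)%VF.

Definition coHom_fun (g : H) (F : 'Hom(E, X)) (e : E) : X :=
  \sw_(g1, g2 <- Delta g) hact g1 (F (ra e g2)).

Lemma coHom_fun_lin g F : linear (coHom_fun g F).
Proof. by rewrite /coHom_fun; lin. Qed.

Definition coHom_r g F : 'Hom(E, X) := lfun_of (coHom_fun_lin g F).

Lemma coHom_ll1 F : linear (coHom_l^~ F). Proof. by rewrite /coHom_l; lin. Qed.
Lemma coHom_ll2 a : linear (coHom_l a). Proof. by rewrite /coHom_l; lin. Qed.
Lemma coHom_lr1 F : linear (coHom_r^~ F).
Proof.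
move=> c u v; apply/lfunP => e; rewrite add_lfunE scale_lfunE !lfun_ofE.
suff: linear (fun g => coHom_fun g F e) by apply.
by rewrite /coHom_fun; lin.
Qed.
Lemma coHom_lr2 g : linear (coHom_r g).
Proof.
move=> c u v; apply/lfunP => e; rewrite add_lfunE scale_lfunE !lfun_ofE.
suff: linear (fun F => coHom_fun g F e) by apply.
by rewrite /coHom_fun; lin.
Qed.

Lemma coHom_l1 F : coHom_l 1 F = F.
Proof. by apply/lfunP => e; rewrite comp_lfunE; apply: lmulA1. Qed.
Lemma coHom_lM a b F : coHom_l (a * b) F = coHom_l a (coHom_l b F).
Proof. by apply/lfunP => e; rewrite !comp_lfunE; apply: lmulAM. Qed.
Lemma coHom_r1 F : coHom_r 1 F = F.
Proof.
apply/lfunP => e; rewrite lfun_ofE /coHom_fun.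
rewrite (sw_Delta1 (fun x y => hact x (F (ra e y)))); [|by lin|by lin].
by rewrite hact1 ra1.
Qed.
Lemma coHom_rM g h F : coHom_r (g * h) F = coHom_r g (coHom_r h F).
Proof.
apply/lfunP => e; rewrite !lfun_ofE /coHom_fun.
rewrite (sw_DeltaM g h (fun x y => hact x (F (ra e y)))); [|by lin|by lin].
apply: eq_sw => a b; rewrite lfun_ofE /coHom_fun (sw_map (hact a)); last by lin.
by apply: eq_sw => c d; rewrite hactM raM.
Qed.
Lemma coHom_rl h a F : coHom_r h (coHom_l a F) =
  \sw_(x, y <- Delta h) coHom_l (act x a) (coHom_r y F).
Proof.
apply/lfunP => e; rewrite lfun_ofE (sw_map (fun f : 'Hom(E, X) => f e)); last by lin.
transitivity (\sw_(x, z <- Delta h) \sw_(c, y <- Delta x)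
   lmulA (act c a) (hact y (F (ra e z)))).
  by apply: eq_sw => x z; rewrite comp_lfunE -[sact _ _ _]/(lmulA a _) hact_lmulA.
rewrite sw_Delta_assoc; try by lin.
apply: eq_sw => x y; rewrite comp_lfunE lfun_ofE -[sact _ _ _]/(lmulA _ _).
by rewrite (sw_map (lmulA _)) //; lin.
Qed.

Definition coHom : smashModule A := build_smash coHom_ll1 coHom_ll2 coHom_lr1
  coHom_lr2 coHom_l1 coHom_lM coHom_r1 coHom_rM coHom_rl.

Lemma coHom_lmulA a (F : coHom) e :
  (lmulA a F : 'Hom(E, X)) e = lmulA a ((F : 'Hom(E, X)) e).
Proof. by rewrite build_lmulA comp_lfunE. Qed.

Lemma coHom_hact h (F : coHom) e :
  (hact h F : 'Hom(E, X)) e =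
  \sw_(g1, g2 <- Delta h) hact g1 ((F : 'Hom(E, X)) (ra e g2)).
Proof. by rewrite build_hact lfun_ofE. Qed.

End CoHom.

End Hom.

Section Emb.
Context (k : fieldType) (H : hopfAlgebra k) (A : moduleAlgebra H).
Implicit Types (g h : H) (a b : A).

(** For E = H this is isomorphic to the module coinduced from the A-module X, by
    F |-> (h |-> h_1 F(h_2)). *)
Definition coinduced (X : smashModule A) : smashModule A :=
  @coHom k H A X H (fun e h => e * h) (fun h => ltac:(lin)) (fun e => ltac:(lin))
    (@mulr1 H) (@mulrA H).

Lemma counit_scale1 (E : vectType k) (e : E) : counit (1 : H) *: e = e.
Proof. by rewrite counit1 scale1r. Qed.

Lemma counit_scaleM (E : vectType k) (e : E) g h :
  counit (g * h) *: e = counit h *: (counit g *: e).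
Proof. by rewrite counitM scalerA mulrC. Qed.

(** For E with the trivial action this is the direct sum of dim E copies of X,
    now as A#H-modules. *)
Definition smash_power (E : vectType k) (X : smashModule A) : smashModule A :=
  @coHom k H A X E (fun e h => counit h *: e) (fun h => ltac:(lin))
    (fun e => ltac:(lin)) (@counit_scale1 E) (@counit_scaleM E).

Lemma smash_power_hact (E : vectType k) (X : smashModule A) h (F : smash_power E X) (e : E) :
  (hact h F : 'Hom(E, X)) e = hact h ((F : 'Hom(E, X)) e).
Proof.
rewrite coHom_hact -[in RHS](sw_counitr (fun x => hact x ((F : 'Hom(E, X)) e))).
  by apply: eq_sw => x y; rewrite linearZ /= -[hact x _]/(sact _ _ _) linearZ.
by lin.
Qed.

Section Coind.
Variables (N X : smashModule A) (g : 'Hom(N, X)).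

(** The A#H-linear map attached to an A-linear g : N -> X by the universal
    property of coinduction, n |-> (h |-> g(h n)), transported to [coinduced]. *)
Definition to_coinduced_fun (n : N) (h : H) : X :=
  \sw_(y, z <- Delta h) hact (antipode y) (g (hact z n)).

Lemma to_coinduced_fun_lin1 h : linear (to_coinduced_fun^~ h).
Proof. by rewrite /to_coinduced_fun; lin. Qed.
Lemma to_coinduced_fun_lin2 n : linear (to_coinduced_fun n).
Proof. by rewrite /to_coinduced_fun; lin. Qed.

Definition to_coinduced : 'Hom(N, coinduced X) :=
  lfun_of (bilin_subproof to_coinduced_fun_lin1 to_coinduced_fun_lin2).

Lemma to_coinducedE n h : (to_coinduced n : 'Hom(H, X)) h = to_coinduced_fun n h.
Proof. by rewrite lfun_ofE lfun_ofE. Qed.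

Lemma to_coinduced_fun1 n : to_coinduced_fun n 1 = g n.
Proof.
rewrite /to_coinduced_fun (sw_Delta1 (fun y z => hact (antipode y) (g (hact z n)))).
- by rewrite antipode1 !hact1.
- by lin.
- by lin.
Qed.

Lemma to_coinduced_hom : (forall a n, g (lmulA a n) = lmulA a (g n)) -> smash_hom to_coinduced.
Proof.
move=> gA; apply: smash_homP => [a n|c n]; apply/lfunP => h; rewrite to_coinducedE.
  rewrite coHom_lmulA to_coinducedE /to_coinduced_fun.
  transitivity (\sw_(y, z <- Delta h) \sw_(u, v <- Delta z)
      hact (antipode y) (lmulA (act u a) (g (hact v n)))).
    apply: eq_sw => y z; rewrite hact_lmulA (sw_map g); last by lin.
    rewrite (sw_map (hact (antipode y))); last by lin.
    by apply: eq_sw => u v; rewrite gA.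
  rewrite -sw_Delta_assoc; try by lin.
  rewrite (sw_map (lmulA a)); last by lin.
  by apply: eq_sw => y z; rewrite antipode_lmulA.
rewrite coHom_hact.
transitivity (\sw_(u, v <- Delta c) hact u (to_coinduced_fun n (h * v))); last first.
  by apply: eq_sw => u v; rewrite to_coinducedE.
rewrite /to_coinduced_fun (hact_antipode_shift (K := fun z => g (hact z n))); last by lin.
by apply: eq_sw => y z; rewrite hactM.
Qed.

End Coind.

Section Family.
Variables (N Y : smashModule A) (E : vectType k) (phi : E -> 'Hom(N, Y)).
Hypothesis phi_lin : linear phi.
Hypothesis phi_hom : forall e, smash_hom (phi e).

Definition family_hom : 'Hom(N, smash_power E Y) :=
  lfun_of (bilin_subproof (f := fun n e => phi e n)
     (fun e => ltac:(lin)) (fun n => ltac:(lin))).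

Lemma family_homE n e : (family_hom n : 'Hom(E, Y)) e = phi e n.
Proof. by rewrite lfun_ofE lfun_ofE. Qed.

Lemma family_hom_hom : smash_hom family_hom.
Proof.
apply: smash_homP => [a n|c n]; apply/lfunP => e; rewrite family_homE.
  by rewrite coHom_lmulA family_homE hom_lmulA.
by rewrite smash_power_hact family_homE hom_hact.
Qed.

End Family.

Section Sep.
Variable x : tensor A A.
Hypothesis xM1 : \sw_(x1, x2 <- x) (x1 * x2) = 1.
Hypothesis Asimple : H_simple A.

Lemma coord_eq0 (V : vectType k) (v : V) :
  (forall i, coord (vbasis {:V}) i v = 0) -> v = 0.
Proof.
move=> v0; rewrite (coord_vbasis (memvf v)) big1 // => i _.
by rewrite v0 scale0r.
Qed.

(** If x^1 f(x^2 n) = 0 for all f and n, then x maps to zero in End(X) (x) Hom(U, N).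
    As A acts faithfully on X and on U, this forces x = 0, contradicting
    x^1 x^2 = 1.  The two factors are treated in turn, testing against
    coordinates of N and then of A. *)
Lemma sep_nondeg (N X : smashModule A) (U : {vspace N}) :
  fullv <> 0%VS :> {vspace X} -> invariant U ->
  (forall (f : 'Hom(N, X)) n, n \in U -> sep_fun x f n = 0) -> U = 0%VS.
Proof.
move=> X0 iU E0; case: (U =P 0%VS) => // U0; exfalso.
have E1 n i : n \in U ->
    \sw_(a, b <- x) (coord (vbasis {:N}) i (lmulA b n) *: a) = 0.
  move=> nU; apply: (faithful (M := X) Asimple _ X0).
    by move=> s m _; apply: memvf.
  move=> m _.
  have lf : linear (fun n => coord (vbasis {:N}) i n *: m).
    by move=> c u v; rewrite linearP scalerDl scalerA.
  have := E0 (lfun_of lf) _ nU; rewrite /sep_fun => <-.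
  rewrite (sw_map (fun a => lmulA a m)); last by lin.
  apply: eq_sw => a b; rewrite lfun_ofE.
  rewrite (lin_Z (lmulA a)); last by lin.
  by rewrite (lin_Z (fun a => lmulA a m)) //; lin.
have E2 i : \sw_(a, b <- x) (coord (vbasis {:A}) i a *: b) = 0.
  apply: (faithful Asimple iU U0) => n nU; apply: coord_eq0 => j.
  have l1 : linear (fun n => coord (vbasis {:N}) j n : k^o).
    by move=> c u v; rewrite linearP.
  have l2 : linear (fun a => coord (vbasis {:A}) i a : k^o).
    by move=> c u v; rewrite linearP.
  rewrite (sw_map (fun a => lmulA a n)); last by lin.
  rewrite (sw_map _ l1).
  transitivity (\sw_(a, b <- x) (coord (vbasis {:A}) i
      (coord (vbasis {:N}) j (lmulA b n) *: a) : k^o)); last first.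
    by rewrite -(sw_map _ l2) E1 ?linear0.
  apply: (eq_sw (W := k^o)) => a b.
  rewrite (lin_Z (fun a => lmulA a n)); last by lin.
  by rewrite !linearZ /= mulrC.
have: (1 : A) = 0; last by apply/eqP; rewrite oner_eq0.
rewrite -xM1.
transitivity (\sum_(i < \dim {:A}) (vbasis {:A})`_i *
    (\sw_(a, b <- x) (coord (vbasis {:A}) i a *: b)) : A); last first.
  by rewrite big1 // => i _; rewrite E2 mulr0.
rewrite [RHS](eq_bigr (fun i : 'I_(\dim {:A}) => \sw_(a, b <- x)
    (coord (vbasis {:A}) i a *: (vbasis {:A})`_i * b))); last first.
  move=> i _; rewrite (sw_map (fun b => (vbasis {:A})`_i * b)); last by lin.
  by apply: eq_sw => a b; rewrite -scalerAl -scalerAr.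
rewrite /sweedler [RHS]exchange_big /=; apply: eq_bigr => i _.
rewrite [RHS]exchange_big /=; apply: eq_bigr => j _.
rewrite -scaler_sumr -mulr_suml; congr (_ *: (_ * _)).
exact: coord_vbasis (memvf _).
Qed.

End Sep.
End Emb.

(** * Semisimplicity of the category of modules *)

Section SemisimpleCategory.
Context (k : fieldType) (H : hopfAlgebra k) (A : moduleAlgebra H).
Implicit Types (g h : H) (a b : A) (M N X Y : smashModule A).

Lemma sw_mem (U V W : vectType k) (t : tensor U V) (f : U -> V -> W) (S : {vspace W}) :
  (forall u v, f u v \in S) -> sweedler t f \in S.
Proof.
move=> fS; rewrite /sweedler; apply: memv_suml => i _.
by apply: memv_suml => j _; apply: memvZ.
Qed.

Lemma inj_hom_dim (V W : vectType k) (f : 'Hom(V, W)) :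
  injective f -> \dim (limg f) = \dim {:V}.
Proof.
move=> inj; rewrite limg_dim_eq //; apply/eqP; rewrite -subv0.
apply/subvP => v; rewrite memv_cap memvf memv_ker /= => /eqP fv.
by rewrite memv0; apply/eqP/inj; rewrite fv linear0.
Qed.

Lemma full_neq0 (V : vectType k) : fullv <> 0%VS :> {vspace V} <-> (0 < \dim {:V})%N.
Proof. by rewrite lt0n dimv_eq0; split=> [/eqP|/eqP]. Qed.

Lemma bij_lfun (V W : vectType k) (f : 'Hom(V, W)) :
  lker f = 0%VS -> limg f = fullv -> bijective f.
Proof.
move=> f0 f1; exists (f^-1)%VF; first by apply: lker0_lfunK; apply/eqP.
by move=> w; apply: limg_lfunVK; rewrite f1 memvf.
Qed.

Lemma smash_iso_sym M N : smash_iso M N -> smash_iso N M.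
Proof.
move=> [f [hf [g fK gK]]].
have lg : linear g.
  by move=> c u v; apply: (can_inj fK); rewrite gK linearP /= !gK.
exists (lfun_of lg); split; first by move=> s m; rewrite !lfun_ofE -{1}(gK m) -hf fK.
by exists f => m; rewrite lfun_ofE ?gK ?fK.
Qed.

Lemma smash_iso_trans M N P : smash_iso M N -> smash_iso N P -> smash_iso M P.
Proof.
move=> [f [hf bf]] [g [hg bg]]; exists (g \o f)%VF; split; first exact: comp_hom.
by apply: (eq_bij (bij_comp bg bf)) => m /=; rewrite comp_lfunE.
Qed.

Lemma schur M N (f : 'Hom(M, N)) : smash_simple M -> smash_simple N ->
  smash_hom f -> f <> 0 -> smash_iso M N.
Proof.
move=> [M0 Ms] [N0 Ns] hf f0; exists f; split=> //; apply: bij_lfun.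
  have [//|E] := Ms _ (lker_invariant hf); case: f0; apply/lfunP => m.
  by rewrite zero_lfunE; apply/eqP; rewrite -memv_ker E memvf.
have [E|//] := Ns _ (limg_invariant hf); case: f0; apply/lfunP => m.
by rewrite zero_lfunE; apply/eqP; rewrite -memv0 -E memv_img ?memvf.
Qed.

Variable x : tensor A A.
Hypothesis xC : forall a, \sw_(x1, x2 <- x) ((a * x1) \ox x2) =
                          \sw_(x1, x2 <- x) (x1 \ox (x2 * a)).
Hypothesis xM1 : \sw_(x1, x2 <- x) (x1 * x2) = 1.
Variable t : H.
Hypothesis t1 : counit t = 1.
Hypothesis tR : forall h, t * h = counit h *: t.

(** Maschke's theorem: the kernel of the averaged projection onto U. *)
Lemma inv_compl M (U : {vspace M}) : invariant U ->
  exists U' : {vspace M}, [/\ invariant U', (U :&: U' = 0)%VS & (U + U' = fullv)%VS].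
Proof.
move=> iU; pose f := avg x t (projv U : 'Hom(M, M)).
have hf : smash_hom f := avg_hom xC tR _.
have fid m : m \in U -> f m = m.
  have hi := sub_incl_hom (iU := iU).
  move=> mU; have := avg_factor (psi := sub_incl iU) (f := projv U) xM1 t1 hi hi.
  have: m \in limg (sub_incl iU) by rewrite limg_sub_incl.
  case/memv_imgP => v _ ->; apply=> p; apply: projv_id.
  exact: sub_incl_in.
have fU m : f m \in U.
  rewrite lfun_ofE; apply: sw_mem => y z; apply: (iU); apply: sw_mem => a b.
  by apply: iU; apply: memv_proj.
exists (lker f); split; first exact: lker_invariant.
  apply/eqP; rewrite -subv0; apply/subvP => m; rewrite memv_cap memv_ker memv0.
  by case/andP => /fid->.
apply/vspaceP => m; rewrite memvf; apply/memv_addP; exists (f m) => //.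
exists (m - f m); last by rewrite addrC subrK.
by rewrite memv_ker linearB /= (fid (f m)) // subrr.
Qed.

Definition min_inv M (U : {vspace M}) :=
  [/\ invariant U, U <> 0%VS & forall W : {vspace M}, invariant W -> (W <= U)%VS ->
       W = 0%VS \/ W = U].

Lemma min_inv_exists M (U : {vspace M}) : invariant U -> U <> 0%VS ->
  exists2 W, min_inv W & (W <= U)%VS.
Proof.
have [n] := ubnP (\dim U); elim: n U => // n IHn U; rewrite ltnS => dU iU U0.
case: (classic (exists W : {vspace M},
    [/\ invariant W, (W <= U)%VS, W <> 0%VS & W <> U])) => [[W [iW WU W0 W1]]|nW].
  have dW : (\dim W < n)%N.
    apply: leq_trans dU; rewrite ltn_neqAle dimvS // andbT.
    by apply/eqP => E; apply: W1; apply/eqP; rewrite eqEdim WU E leqnn.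
  have [W' mW' sW'] := IHn _ dW iW W0.
  by exists W' => //; apply: subv_trans WU.
exists U => //; split=> // W iW WU.
case: (classic (W = 0%VS)) => [->|W0]; first by left.
case: (classic (W = U)) => [->|W1]; first by right.
by case: nW; exists W.
Qed.

Lemma invariantI M (U V : {vspace M}) : invariant U -> invariant V -> invariant (U :&: V)%VS.
Proof. by move=> iU iV s m; rewrite !memv_cap => /andP[/iU-> /iV->]. Qed.

(** Directness of the sum is recorded by the dimension equality. *)
Lemma inv_decomp M (U : {vspace M}) : invariant U ->
  exists s : seq {vspace M},
    [/\ forall i, (i < size s)%N -> min_inv (nth 0%VS s i),
        (\sum_(i < size s) nth 0%VS s i)%VS = U
      & \dim U = (\sum_(i < size s) \dim (nth 0%VS s i))%N].
Proof.
have [n] := ubnP (\dim U); elim: n U => // n IHn U; rewrite ltnS => dU iU.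
case: (classic (U = 0%VS)) => [->|U0].
  by exists [::]; rewrite /= !big_ord0 dimv0; split.
have [W [iW W0 Wm] WU] := min_inv_exists iU U0.
have [W' [iW' WW' sW']] := inv_compl iW.
have E : (W + (U :&: W') = U)%VS.
  apply/vspaceP => m; apply/idP/idP => [|mU].
    case/memv_addP => u uW [v]; rewrite memv_cap => /andP[vU _] ->.
    by rewrite memvD // (subvP WU).
  have: m \in (W + W')%VS by rewrite sW' memvf.
  case/memv_addP => u uW [v vW' mE]; apply/memv_addP; exists u => //; exists v => //.
  rewrite memv_cap vW' andbT.
  have -> : v = m - u by rewrite mE addrC addKr.
  by rewrite memvB // (subvP WU).
have dE : \dim U = (\dim W + \dim (U :&: W'))%N.
  rewrite -{1}E dimv_disjoint_sum //; apply/eqP; rewrite -subv0 -WW' subv_cap capvSl /=.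
  exact: subv_trans (capvSr _ _) (capvSr _ _).
have dW : (0 < \dim W)%N by rewrite lt0n dimv_eq0; apply/eqP.
have dU' : (\dim (U :&: W') < n)%N.
  by apply: leq_trans dU; rewrite dE -[X in (X < _)%N]add0n ltn_add2r.
have [s [ms sE sd]] := IHn _ dU' (invariantI iU iW').
exists (W :: s); split.
- by case=> // i; apply: ms.
- by rewrite /= big_ord_recl /= sE.
- by rewrite /= big_ord_recl /= -sd.
Qed.

Lemma sub_simple M (U : {vspace M}) (iU : invariant U) :
  min_inv U -> smash_simple (sub_smash iU).
Proof.
move=> [_ U0 Um]; split.
  by apply/full_neq0; rewrite dim_sub_smash lt0n dimv_eq0; apply/eqP.
move=> V iV; pose W := (sub_incl iU @: V)%VS.
have iW : invariant W.
  move=> s _ /memv_imgP[v vV ->]; rewrite -(sub_incl_hom (iU := iU)).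
  by apply: memv_img; apply: iV.
have WU : (W <= U)%VS by rewrite -(limg_sub_incl iU) limgS ?subvf.
have dW : \dim W = \dim V.
  rewrite limg_dim_eq //; apply/eqP; rewrite -subv0; apply/subvP => v.
  rewrite memv_cap memv_ker memv0 => /andP[_ /eqP E].
  by apply/eqP/(@sub_incl_inj _ _ _ _ _ iU); rewrite E linear0.
case: (Um W iW WU) => E.
  by left; apply/eqP; rewrite -dimv_eq0 -dW E dimv0.
by right; apply/eqP; rewrite eqEdim subvf -dW E dim_sub_smash leqnn.
Qed.

Lemma simple_decomp M : exists (n : nat) (S : 'I_n -> smashModule A)
    (f : forall i, 'Hom(S i, M)),
  [/\ forall i, smash_simple (S i) /\ smash_hom (f i) /\ injective (f i),
      (\sum_i limg (f i) = fullv)%VS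
    & \dim {:M} = (\sum_i \dim {:S i})%N].
Proof.
have iM : invariant (fullv : {vspace M}) by move=> s m _; apply: memvf.
have [s [ms sE sd]] := inv_decomp iM.
have iS (i : 'I_(size s)) : invariant (nth 0%VS s i) by have [] := ms _ (ltn_ord i).
exists (size s), (fun i => sub_smash (iS i)), (fun i => sub_incl (iS i)); split.
- move=> i; split; first by apply: sub_simple; apply: ms.
  by split; [apply: sub_incl_hom | apply: sub_incl_inj].
- by rewrite -[RHS]sE; apply: eq_bigr => i _; rewrite limg_sub_incl.
- by rewrite sd; apply: eq_bigr => i _; rewrite dim_sub_smash.
Qed.

Lemma iso_representatives n (S : 'I_n -> smashModule A) :
  (forall i, smash_simple (S i)) ->
  exists (r : nat) (X : 'I_r -> smashModule A),
    [/\ forall i, smash_simple (X i),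
        forall i j, smash_iso (X i) (X j) -> i = j
      & forall i, exists j, smash_iso (S i) (X j)].
Proof.
elim: n S => [|n IHn] S Ss.
  have I0F (i : 'I_0) : False by case: i.
  by exists 0%N, S; split=> i; case: (I0F i).
have [r [X [Xs Xi Xc]]] := IHn (fun i => S (lift ord_max i)) (fun i => Ss _).
case: (classic (exists j, smash_iso (S ord_max) (X j))) => [Ej|nEj].
  exists r, X; split=> // i; case: (unliftP ord_max i) => [j ->|->//].
  exact: Xc.
pose X' (i : 'I_r.+1) := if unlift ord_max i is Some j then X j else S ord_max.
exists r.+1, X'; split.
- by move=> i; rewrite /X'; case: unliftP => [j _|_].
- move=> i j; rewrite /X'; case: unliftP => [i' ->|->]; case: unliftP => [j' ->|->] //.
  + by move/Xi->.
  + by move/smash_iso_sym => E; case: nEj; exists i'.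
  + by move=> E; case: nEj; exists j'.
- move=> i; case: (unliftP ord_max i) => [j ->|->].
    by have [j' E] := Xc j; exists (lift ord_max j'); rewrite /X' liftK.
  exists ord_max; rewrite /X' unlift_none; exists \1%VF; split; first exact: id_hom.
  by exists id => m; rewrite id_lfunE.
Qed.

Hypothesis Asimple : H_simple A.

Lemma unit_neq0 : fullv <> 0%VS :> {vspace (unit_smash A)}.
Proof.
move=> E; have : (1 : A) \in (fullv : {vspace (unit_smash A)}) by apply: memvf.
by rewrite E memv0 oner_eq0.
Qed.

Lemma retract M N (phi : 'Hom(N, M)) : smash_hom phi -> injective phi ->
  exists2 rho : 'Hom(M, N), smash_hom rho & forall n, rho (phi n) = n.
Proof.
move=> hphi inj; exists (avg x t (phi^-1)%VF); first exact: (avg_hom xC tR).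
move=> n; rewrite (avg_factor (psi := \1%VF) xM1 t1 hphi) ?id_lfunE //.
  exact: id_hom.
move=> p; rewrite id_lfunE; apply: lker0_lfunK; rewrite -subv0.
by apply/subvP => m; rewrite memv_ker memv0 => /eqP E; apply/eqP/inj; rewrite E linear0.
Qed.

(** Every simple M embeds in the single module coinduced from A, hence occurs
    among the finitely many summands of one of its decompositions. *)
Lemma exists_simple_system :
  exists (r : nat) (X : 'I_r -> smashModule A), simple_system X.
Proof.
pose Y := coinduced (unit_smash A).
have [n [S [f [fP fE _]]]] := simple_decomp Y.
have [r [X [Xs Xi Xc]]] := iso_representatives (fun i => proj1 (fP i)).
exists r, X; split=> // M [M0 Ms].
have [g gn0] : exists g : 'Hom(M, unit_smash A), lfun_of (sep_fun_lin2 x g) <> 0.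
  apply: NNPP => nE; case: M0.
  apply: (sep_nondeg xM1 Asimple unit_neq0) => [s m _|g m _]; first exact: memvf.
  apply: NNPP => gm; case: nE; exists g => E; apply: gm.
  by rewrite -(lfun_ofE (sep_fun_lin2 x g)) E zero_lfunE.
pose phi := to_coinduced (lfun_of (sep_fun_lin2 x g)).
have hphi : smash_hom phi.
  by apply: to_coinduced_hom => a m; rewrite !lfun_ofE sep_fun_lmulA.
have phi0 : lker phi = 0%VS.
  case: (Ms _ (lker_invariant hphi)) => // E; case: gn0; apply/lfunP => m.
  rewrite -to_coinduced_fun1 -to_coinducedE -/phi zero_lfunE.
  have /eqP-> : phi m == 0 by rewrite -memv_ker E memvf.
  by rewrite zero_lfunE.
have [rho hrho rhoK] : exists2 rho : 'Hom(Y, M), smash_hom rho & forall m, rho (phi m) = m.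
  by apply: retract => //; apply/lker0P; rewrite phi0.
have [i fi0] : exists i, (rho \o f i)%VF <> 0.
  apply: NNPP => nE; case: M0.
  have r0 : (rho @: fullv = 0)%VS.
    rewrite -fE limg_sum big1 // => i _; rewrite -limg_comp.
    suff -> : (rho \o f i)%VF = 0 by rewrite lim0g.
    by apply: NNPP => E; apply: nE; exists i.
  apply/eqP; rewrite -subv0 -r0; apply/subvP => m _.
  by rewrite -[m]rhoK memv_img ?memvf.
have [[Ss [hf _]]] := (fP i, I).
have [j Ej] := Xc i; exists j; apply: smash_iso_trans Ej.
apply/smash_iso_sym/(schur Ss _ _ fi0) => //; exact: comp_hom.
Qed.

(** The summands [S i] of a decomposition are regrouped by isomorphism type
    [tau i]; the l-th copy of [X j] is the l-th index i with tau i = j. *)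
Lemma Gr_class_exists r (X : 'I_r -> smashModule A) M :
  simple_system X -> exists c : 'I_r -> nat, Gr_class X M c.
Proof.
move=> [Xs Xi Xc]; have [n [S [f [fP fE fd]]]] := simple_decomp M.
have [tau tauP] : exists tau : 'I_n -> 'I_r, forall i, smash_iso (X (tau i)) (S i).
  apply: (fin_all_exists (P := fun i j => smash_iso (X j) (S i))) => i.
  by have [j /smash_iso_sym E] := Xc _ (proj1 (fP i)); exists j.
have [F FP] : exists F : forall i, 'Hom(X (tau i), M), forall i,
    [/\ smash_hom (F i), injective (F i) & limg (F i) = limg (f i)].
  apply: (fin_all_exists (P := fun i (g : 'Hom(X (tau i), M)) =>
    [/\ smash_hom g, injective g & limg g = limg (f i)])) => i.
  have [g [hg bg]] := tauP i; have [_ [hf fi]] := fP i.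
  exists (f i \o g)%VF; split; first exact: comp_hom.
    by move=> u v; rewrite !comp_lfunE => /fi; apply: bij_inj.
  rewrite limg_comp; congr (f i @: _)%VS; apply/vspaceP => v; rewrite memvf.
  by have [g' _ gK] := bg; rewrite -[v]gK memv_img ?memvf.
pose c j := #|[pred i | tau i == j]|.
(* F i is a map out of X (tau i), to be used as a map out of X j. *)
pose G i j (e : tau i = j) : 'Hom(X j, M) := ecast j ('Hom(X j, M)) e (F i).
have GE i j (e : tau i = j) :
    [/\ smash_hom (G i j e), injective (G i j e) & limg (G i j e) = limg (f i)].
  by rewrite /G; case: j / e; apply: FP.
have el j (l : 'I_(c j)) : tau (enum_val l) = j.
  by have := enum_valP l; rewrite inE => /eqP.
exists c, (fun j l => G _ j (el j l)) => /=.
pose img (p : {j : 'I_r & 'I_(c j)}) :=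
  limg (G _ (tag p) (el _ (tagged p))).
have imgE p : img p = limg (f (enum_val (tagged p))).
  by rewrite /img; have [_ _ ->] := GE _ _ (el _ (tagged p)).
have reind (T : Type) (idx : T) (op : Monoid.com_law idx) (v : 'I_n -> T) :
    \big[op/idx]_(p : {j : 'I_r & 'I_(c j)}) v (enum_val (tagged p)) =
    \big[op/idx]_i v i.
  rewrite (partition_big tau xpredT) //=.
  rewrite -(sig_big_dep xpredT (fun _ => xpredT) (fun j (l : 'I_(c j)) => v (enum_val l))) /=.
  by apply: eq_bigr => j _; rewrite -big_enum_val.
have sE : (\sum_p img p = fullv)%VS.
  rewrite -fE -(reind _ _ _ (fun i => limg (f i))).
  by apply: eq_bigr => p _; apply: imgE.
split=> //.
- by move=> j l; have [? ? _] := GE _ _ (el j l).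
- rewrite directvE /= [X in \dim X]sE; apply/eqP.
  rewrite fd -(reind _ _ _ (fun i => \dim {:S i})).
  apply: eq_bigr => p _; rewrite -/(img p) imgE inj_hom_dim //.
  by have [_ []] := fP (enum_val (tagged p)).
Qed.

Lemma Gr_class_dim r (X : 'I_r -> smashModule A) M c :
  Gr_class X M c -> \dim {:M} = (\sum_j c j * \dim {:X j})%N.
Proof.
move=> [f [fP /directvP fd fE]]; rewrite -fE fd /=.
rewrite -(sig_big_dep xpredT (fun _ => xpredT)
  (fun j (l : 'I_(c j)) => \dim (limg (f j l)))) /=.
apply: eq_bigr => j _; rewrite (eq_bigr (fun=> \dim {:X j})) => [|l _].
  by rewrite sum_nat_const card_ord.
by apply: inj_hom_dim; have [] := fP j l.
Qed.

End SemisimpleCategory.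

(** * The tensor product over A *)

Section Rmul.
Context (k : fieldType) (H : hopfAlgebra k) (R : tensor H H).
Context (A : moduleAlgebra H).
Implicit Types (g h : H) (a b c : A) (M N X : smashModule A).
Hypothesis Rqt : quasitriangular R.
Hypothesis Aqc : quantum_commutative A R.

Lemma sw_qt_Delta (W : lmodType k) h (f : H -> H -> W) :
  (forall q, linear (f^~ q)) -> (forall p, linear (f p)) ->
  \sw_(r1, r2 <- R) \sw_(h1, h2 <- Delta h) f (r1 * h1) (r2 * h2) =
  \sw_(r1, r2 <- R) \sw_(h1, h2 <- Delta h) f (h2 * r1) (h1 * r2).
Proof.
move=> l1 l2; pose F (t : tensor H H) := \sw_(p, q <- t) f p q.
have lF : linear F by rewrite /F; lin.
have FE p q : F (p \ox q) = f p q by rewrite /F sweedler_tens.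
have := congr1 F (qt_Delta Rqt h); rewrite !(sw_map _ lF).
move=> E; transitivity (\sw_(r1, r2 <- R)
    F (\sw_(h1, h2 <- Delta h) ((r1 * h1) \ox (r2 * h2)))).
  by apply: eq_sw => r1 r2; rewrite (sw_map _ lF); apply: eq_sw => h1 h2.
rewrite E; apply: eq_sw => r1 r2; rewrite (sw_map _ lF).
by apply: eq_sw => h1 h2.
Qed.

Lemma sw_trilinear_lift (W : lmodType k) (f : H -> H -> H -> W) :
  (forall q r, linear (fun p => f p q r)) ->
  (forall p r, linear (fun q => f p q r)) ->
  (forall p q, linear (f p q)) ->
  {F : tensor (tensor H H) H -> W | linear F & forall p q r, F ((p \ox q) \ox r) = f p q r}.
Proof.
move=> l1 l2 l3.
exists (fun t => \sw_(s, z <- t) \sw_(a, b <- s) f a b z); first by lin.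
move=> p q r; rewrite sweedler_tens; [| by lin | by lin].
by rewrite sweedler_tens; [| by lin | by lin].
Qed.

Lemma sw_qt_Deltal (W : lmodType k) (f : H -> H -> H -> W) :
  (forall q r, linear (fun p => f p q r)) ->
  (forall p r, linear (fun q => f p q r)) ->
  (forall p q, linear (f p q)) ->
  \sw_(r1, r2 <- R) \sw_(p, q <- Delta r1) f p q r2 =
  \sw_(r1, r2 <- R) \sw_(s1, s2 <- R) f r1 s1 (r2 * s2).
Proof.
move=> l1 l2 l3; have [F lF FE] := sw_trilinear_lift l1 l2 l3.
have := congr1 F (qt_Deltal Rqt); rewrite !(sw_map _ lF).
move=> E; transitivity (\sw_(r1, r2 <- R)
    F (\sw_(p, q <- Delta r1) ((p \ox q) \ox r2))).
  by apply: eq_sw => r1 r2; rewrite (sw_map _ lF); apply: eq_sw => h1 h2.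
rewrite E; apply: eq_sw => r1 r2; rewrite (sw_map _ lF).
by apply: eq_sw => h1 h2.
Qed.

Lemma sw_qt_Deltar (W : lmodType k) (f : H -> H -> H -> W) :
  (forall q r, linear (fun p => f p q r)) ->
  (forall p r, linear (fun q => f p q r)) ->
  (forall p q, linear (f p q)) ->
  \sw_(r1, r2 <- R) \sw_(p, q <- Delta r2) f r1 p q =
  \sw_(r1, r2 <- R) \sw_(s1, s2 <- R) f (r1 * s1) s2 r2.
Proof.
move=> l1 l2 l3; have [F lF FE] := sw_trilinear_lift l1 l2 l3.
have := congr1 F (qt_Deltar Rqt); rewrite !(sw_map _ lF).
move=> E; transitivity (\sw_(r1, r2 <- R)
    F (\sw_(p, q <- Delta r2) ((r1 \ox p) \ox q))).
  by apply: eq_sw => r1 r2; rewrite (sw_map _ lF); apply: eq_sw => h1 h2.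
rewrite E; apply: eq_sw => r1 r2; rewrite (sw_map _ lF).
by apply: eq_sw => h1 h2.
Qed.

Lemma rmulAE M (m : M) a :
  rmulA R m a = \sw_(r1, r2 <- R) lmulA (act r2 a) (hact r1 m).
Proof.
rewrite /rmulA (sw_map (fun s => sact M s m)); last by lin.
by apply: eq_sw => r1 r2; rewrite sact_tens.
Qed.

(** Left and right multiplications commute because A is quantum commutative:
    the copy of R acting across [a] is absorbed by exchanging two elements
    of A. *)
Lemma rmulA_lmulA M a (m : M) b : rmulA R (lmulA a m) b = lmulA a (rmulA R m b).
Proof.
transitivity (\sw_(r1, r2 <- R) \sw_(p, q <- Delta r1)
    lmulA (act r2 b) (lmulA (act p a) (hact q m))).
  rewrite rmulAE; apply: eq_sw => r1 r2; rewrite hact_lmulA.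
  by rewrite (sw_map (lmulA (act r2 b))) //; lin.
rewrite (@sw_qt_Deltal _ (fun p q r => lmulA (act r b) (lmulA (act p a) (hact q m)))); try by lin.
rewrite sw_exch rmulAE (sw_map (lmulA a)); last by lin.
apply: eq_sw => s1 s2; rewrite -lmulAM Aqc (sw_map (fun a => lmulA a (hact s1 m))); last by lin.
by apply: eq_sw => r1 r2; rewrite lmulAM actM.
Qed.

Lemma rmulAM M (m : M) a b : rmulA R m (a * b) = rmulA R (rmulA R m a) b.
Proof.
transitivity (\sw_(r1, r2 <- R) \sw_(s1, s2 <- R)
    lmulA (act s2 a) (lmulA (act r2 b) (hact (r1 * s1) m))).
  rewrite -(@sw_qt_Deltar _ (fun p q r =>
    lmulA (act q a) (lmulA (act r b) (hact p m)))); try by lin.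
  rewrite rmulAE; apply: eq_sw => r1 r2; rewrite act_mul.
  rewrite (sw_map (fun a => lmulA a (hact r1 m))); last by lin.
  by apply: eq_sw => p q; rewrite lmulAM.
rewrite sw_exch [in RHS](rmulAE m) (sw_map (fun m => rmulA R m b)); last by lin.
apply: eq_sw => s1 s2; rewrite rmulA_lmulA rmulAE (sw_map (lmulA (act s2 a))); last by lin.
by apply: eq_sw => r1 r2; rewrite hactM.
Qed.

Lemma hact_rmulA M h (m : M) b : hact h (rmulA R m b) =
  \sw_(h1, h2 <- Delta h) rmulA R (hact h1 m) (act h2 b).
Proof.
transitivity (\sw_(r1, r2 <- R) \sw_(h1, h2 <- Delta h)
   lmulA (act (h1 * r2) b) (hact (h2 * r1) m)).
  rewrite rmulAE (sw_map (hact h)); last by lin.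
  apply: eq_sw => r1 r2; rewrite hact_lmulA; apply: eq_sw => h1 h2.
  by rewrite actM hactM.
rewrite -(@sw_qt_Delta _ _ (fun p q => lmulA (act q b) (hact p m))); try by lin.
rewrite sw_exch; apply: eq_sw => h1 h2; rewrite rmulAE; apply: eq_sw => r1 r2.
by rewrite actM hactM.
Qed.

(** With e = R^1 counit(R^2), applying the counit to the last factor of the
    second hexagon identity gives R = (e (x) 1) R, and R is invertible. *)
Lemma qt_counit : \sw_(r1, r2 <- R) (counit r2 *: r1) = 1.
Proof.
have [R' [RR' _]] := qt_inv Rqt.
set e := sweedler _ _.
(* The linear map t |-> (id (x) counit)(t R'). *)
pose L (t : tensor H H) := \sw_(p, q <- t) \sw_(c, d <- R') (counit (q * d) *: (p * c)).
have lL : linear L by rewrite /L; lin.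
have LR : L R = 1.
  pose F (t : tensor H H) := \sw_(p, q <- t) (counit q *: p).
  have lF : linear F by rewrite /F; lin.
  have FE p q : F (p \ox q) = counit q *: p by rewrite /F sweedler_tens //; lin.
  have := congr1 F RR'; rewrite FE counit1 scale1r => <-.
  rewrite /tensor_mul (sw_map _ lF); apply: eq_sw => p q.
  by rewrite (sw_map _ lF); apply: eq_sw => c d; rewrite FE.
have RE : R = \sw_(s1, s2 <- R) ((e * s1) \ox s2).
  transitivity (\sw_(r1, r2 <- R) \sw_(p, q <- Delta r2) (counit q *: (r1 \ox p))).
    rewrite -[LHS]tensor_eta; apply: eq_sw => r1 r2.
    by rewrite (sw_counitr (fun p => r1 \ox p)) //; lin.
  rewrite (@sw_qt_Deltar _ (fun r p q => counit q *: (r \ox p))); try by lin.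
  rewrite sw_exch; apply: eq_sw => s1 s2.
  rewrite /e (sw_map (fun e => (e * s1) \ox s2)); last by lin.
  apply: eq_sw => r1 r2.
  by rewrite (lin_Z (fun r => (r * s1) \ox s2)) //; lin.
rewrite -[LHS]mulr1 -LR [in RHS]RE (sw_map _ lL).
rewrite {1}/L (sw_map (fun z => e * z)); last by lin.
apply: eq_sw => s1 s2; rewrite /L sweedler_tens; [|by lin|by lin].
rewrite (sw_map (fun z => e * z)); last by lin.
by apply: eq_sw => c d; rewrite -scalerAr mulrA.
Qed.

Lemma rmulA1 M (m : M) : rmulA R m 1 = m.
Proof.
rewrite rmulAE -[RHS]hact1 -qt_counit (sw_map (fun h => hact h m)); last by lin.
apply: eq_sw => r1 r2; rewrite act_unit.
rewrite (lin_Z (fun a => lmulA a (hact r1 m))); last by lin.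
by rewrite lmulA1 (lin_Z (fun h => hact h m)) //; lin.
Qed.

Variable x : tensor A A.
Hypothesis xC : forall a, \sw_(x1, x2 <- x) ((a * x1) \ox x2) =
                          \sw_(x1, x2 <- x) (x1 \ox (x2 * a)).
Hypothesis xM1 : \sw_(x1, x2 <- x) (x1 * x2) = 1.

Section Tensor.
Variables M N : smashModule A.

(** The tensor product over k is an A#H-module, A acting on the first factor
    and H diagonally; the module M (x)_A N is a quotient of it. *)
Definition diag_l a (t : tensor M N) : tensor M N :=
  \sw_(m, n <- t) (lmulA a m \ox n).
Definition diag_r h (t : tensor M N) : tensor M N :=
  \sw_(m, n <- t) \sw_(h1, h2 <- Delta h) (hact h1 m \ox hact h2 n).

Lemma diag_l_tens a m n : diag_l a (m \ox n) = lmulA a m \ox n.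
Proof. by rewrite /diag_l sweedler_tens //; lin. Qed.
Lemma diag_r_tens h m n :
  diag_r h (m \ox n) = \sw_(h1, h2 <- Delta h) (hact h1 m \ox hact h2 n).
Proof. by rewrite /diag_r sweedler_tens //; lin. Qed.

Lemma diag_ll1 t : linear (diag_l^~ t). Proof. by rewrite /diag_l; lin. Qed.
Lemma diag_ll2 a : linear (diag_l a). Proof. by rewrite /diag_l; lin. Qed.
Lemma diag_lr1 t : linear (diag_r^~ t). Proof. by rewrite /diag_r; lin. Qed.
Lemma diag_lr2 h : linear (diag_r h). Proof. by rewrite /diag_r; lin. Qed.

Lemma diag_l1 t : diag_l 1 t = t.
Proof.
apply: (tensor_ext (f := diag_l 1) (g := id)); [exact: diag_ll2|exact: lin_id|].
by move=> m n; rewrite diag_l_tens lmulA1.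
Qed.
Lemma diag_lM a b t : diag_l (a * b) t = diag_l a (diag_l b t).
Proof.
move: t; apply: tensor_ext; [exact: diag_ll2| |].
  by apply: lin_comp; apply: diag_ll2.
by move=> m n; rewrite !diag_l_tens lmulAM.
Qed.
Lemma diag_r1 t : diag_r 1 t = t.
Proof.
apply: (tensor_ext (f := diag_r 1) (g := id)); [exact: diag_lr2|exact: lin_id|].
move=> m n; rewrite diag_r_tens.
rewrite (sw_Delta1 (fun p q => hact p m \ox hact q n)); [|by lin|by lin].
by rewrite !hact1.
Qed.
Lemma diag_rM g h t : diag_r (g * h) t = diag_r g (diag_r h t).
Proof.
move: t; apply: tensor_ext; [exact: diag_lr2| |].
  by apply: lin_comp; apply: diag_lr2.
move=> m n; rewrite !diag_r_tens (sw_map _ (diag_lr2 g)).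
rewrite (sw_DeltaM g h (fun p q => hact p m \ox hact q n)); [|by lin|by lin].
rewrite sw_exch; apply: eq_sw => p q; rewrite diag_r_tens.
by apply: eq_sw => p' q'; rewrite !hactM.
Qed.
Lemma diag_rl h a t : diag_r h (diag_l a t) =
  \sw_(p, q <- Delta h) diag_l (act p a) (diag_r q t).
Proof.
move: t; apply: tensor_ext.
- by apply: lin_comp; [apply: diag_lr2|apply: diag_ll2].
- apply: lin_sw => p q; apply: lin_comp; [exact: diag_ll2|exact: diag_lr2].
move=> m n; rewrite diag_l_tens diag_r_tens.
transitivity (\sw_(p, z <- Delta h) \sw_(u, v <- Delta p)
   (lmulA (act u a) (hact v m) \ox hact z n)).
  apply: eq_sw => p z; rewrite hact_lmulA.
  by rewrite (sw_map (fun m => m \ox hact z n)) //; lin.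
rewrite sw_Delta_assoc; try by lin.
apply: eq_sw => p q; rewrite diag_r_tens (sw_map _ (diag_ll2 _)).
by apply: eq_sw => u v; rewrite diag_l_tens.
Qed.

Definition diag_smash : smashModule A := build_smash diag_ll1 diag_ll2 diag_lr1
  diag_lr2 diag_l1 diag_lM diag_r1 diag_rM diag_rl.

Lemma diag_sact a h m n : sact diag_smash (a \ox h) (m \ox n) =
  \sw_(h1, h2 <- Delta h) (lmulA a (hact h1 m) \ox hact h2 n).
Proof.
rewrite sact_tens build_lmulA build_hact diag_r_tens (sw_map _ (diag_ll2 a)).
by apply: eq_sw => p q; rewrite diag_l_tens.
Qed.

(** The tensor product over A is realised as the image of the projector
    m (x) n |-> m x^1 (x) x^2 n, whose kernel is spanned by the relations
    m a (x) n - m (x) a n. *)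
Definition rel_proj_fun (t : tensor M N) : tensor M N :=
  \sw_(m, n <- t) \sw_(a, b <- x) (rmulA R m a \ox lmulA b n).

Lemma rel_proj_lin : linear rel_proj_fun.
Proof. by rewrite /rel_proj_fun; lin. Qed.

Definition rel_proj : 'Hom(tensor M N, tensor M N) := lfun_of rel_proj_lin.

Lemma rel_proj_tens m n :
  rel_proj (m \ox n) = \sw_(a, b <- x) (rmulA R m a \ox lmulA b n).
Proof. by rewrite lfun_ofE /rel_proj_fun sweedler_tens //; lin. Qed.

Lemma rel_proj_balanced : balanced R rel_proj.
Proof.
move=> m c n; rewrite !rel_proj_tens.
transitivity (\sw_(a, b <- x) (rmulA R m (c * a) \ox lmulA b n)).
  by apply: eq_sw => a b; rewrite rmulAM.
rewrite (sw_sepC xC (f := fun a b => rmulA R m a \ox lmulA b n)); try by lin.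
by apply: eq_sw => a b; rewrite lmulAM.
Qed.

Lemma balanced_rel_proj (W : vectType k) (q : 'Hom(tensor M N, W)) t :
  balanced R q -> q (rel_proj t) = q t.
Proof.
move=> bq; move: t; apply: (tensor_ext (f := fun t => q (rel_proj t))); try by lin.
move=> m n; rewrite rel_proj_tens (sw_map q); last by lin.
rewrite -[in RHS](lmulA1 n) -(sw_sep1 xM1 (f := fun a => q (m \ox lmulA a n))); last by lin.
by apply: eq_sw => a b; rewrite bq lmulAM.
Qed.

Lemma rel_projK t : rel_proj (rel_proj t) = rel_proj t.
Proof. exact: balanced_rel_proj rel_proj_balanced. Qed.

(** The action of A#H preserves the relations. *)
Lemma sact_balanced s : balanced R (rel_proj \o sact diag_smash s)%VF.
Proof.
move=> m c n; rewrite !comp_lfunE.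
apply: (tensor_ext (f := fun s => rel_proj (sact diag_smash s (rmulA R m c \ox n)))
  (g := fun s => rel_proj (sact diag_smash s (m \ox lmulA c n))) _ _ _ s); try by lin.
move=> {s} a h; rewrite !diag_sact !(sw_map rel_proj); try by lin.
transitivity (\sw_(p, z <- Delta h) \sw_(u, v <- Delta p)
   rel_proj (lmulA a (hact u m) \ox lmulA (act v c) (hact z n))).
  apply: eq_sw => p z; rewrite hact_rmulA.
  rewrite (sw_map (fun m => rel_proj (lmulA a m \ox hact z n))); last by lin.
  apply: eq_sw => u v; rewrite -rmulA_lmulA.
  by rewrite rel_proj_balanced.
rewrite sw_Delta_assoc; try by lin.
apply: eq_sw => p z; rewrite hact_lmulA.
by rewrite (sw_map (fun n => rel_proj (lmulA a (hact p m) \ox n))) //; lin.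
Qed.

Let incl : 'Hom(subvs_of (limg rel_proj), diag_smash) := linfun vsval.

Definition toA_vs : 'Hom(tensor M N, subvs_of (limg rel_proj)) :=
  (linfun (vsproj (limg rel_proj)) \o rel_proj)%VF.

Lemma toA_vsK t : incl (toA_vs t) = rel_proj t.
Proof.
rewrite comp_lfunE lfunE /= [linfun (vsproj _) _]lfunE /= vsprojK //.
by apply: memv_img; apply: memvf.
Qed.

Lemma toA_pi v : toA_vs (incl v) = v.
Proof.
apply: val_inj; have := toA_vsK (incl v); rewrite lfunE /= => ->.
by have /memv_imgP[y _] := subvsP v; rewrite [incl v]lfunE /= => ->; rewrite rel_projK.
Qed.

Lemma toA_pM s t v : toA_vs (sact diag_smash s (incl (toA_vs (sact diag_smash t (incl v))))) =
   toA_vs (sact diag_smash s (sact diag_smash t (incl v))).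
Proof.
rewrite toA_vsK comp_lfunE [in RHS]comp_lfunE; congr (_ _).
have := balanced_rel_proj (sact diag_smash t (incl v)) (@sact_balanced s).
by rewrite !comp_lfunE.
Qed.

Definition toA : smashModule A :=
  @transport k H A diag_smash _ incl toA_vs toA_pi toA_pM.

Definition toA_proj : 'Hom(tensor M N, toA) := toA_vs.

Lemma toA_proj_surj v : exists t, v = toA_proj t.
Proof. by exists (incl v); rewrite /toA_proj toA_pi. Qed.

Lemma balanced_toA (W : vectType k) (q : 'Hom(tensor M N, W)) : balanced R q ->
  exists f : 'Hom(toA, W), forall t, q t = f (toA_proj t).
Proof.
move=> bq; exists (q \o incl)%VF => t.
by rewrite comp_lfunE toA_vsK balanced_rel_proj.
Qed.

Lemma toA_proj_balanced : balanced R toA_proj.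
Proof. by move=> m c n; rewrite /toA_proj !comp_lfunE rel_proj_balanced. Qed.

Lemma toA_tensor : tensor_over_A R toA_proj.
Proof.
split.
- exact: toA_proj_balanced.
- move=> W q bq; have [f fE] := balanced_toA bq; exists f; split=> // f' f'E.
  by apply/lfunP => v; have [t ->] := toA_proj_surj v; rewrite -fE f'E.
- move=> a h m n; rewrite transportE toA_vsK.
  have E : toA_vs (sact diag_smash (a \ox h) (rel_proj (m \ox n))) =
      toA_vs (sact diag_smash (a \ox h) (m \ox n)).
    rewrite comp_lfunE [in RHS]comp_lfunE; congr (_ _).
    have := balanced_rel_proj (m \ox n) (@sact_balanced (a \ox h)).
    by rewrite !comp_lfunE.
  rewrite E diag_sact (sw_map toA_vs); last by lin.
  by apply: eq_sw => h1 h2; rewrite sact_tens.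
Qed.

End Tensor.
End Rmul.

(** * Dimensions of tensor products *)

Section Dim.
Context (k : fieldType) (H : hopfAlgebra k) (R : tensor H H).
Context (A : moduleAlgebra H).
Implicit Types (g h : H) (a b c : A) (M N X : smashModule A).
Hypothesis Rqt : quasitriangular R.
Hypothesis Aqc : quantum_commutative A R.
Variable x : tensor A A.
Hypothesis xC : forall a, \sw_(x1, x2 <- x) ((a * x1) \ox x2) =
                          \sw_(x1, x2 <- x) (x1 \ox (x2 * a)).
Hypothesis xM1 : \sw_(x1, x2 <- x) (x1 * x2) = 1.

(** The dimension of M (x)_A N. *)
Definition tdim M N := \dim (limg (rel_proj R x M N)).

Lemma dim_toA M N : \dim {:toA Rqt Aqc xC xM1 M N} = tdim M N.
Proof. by rewrite dimvf. Qed.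

Lemma limg_balanced M N (W : vectType k) (q : 'Hom(tensor M N, W)) :
  balanced R q -> limg q = (q @: limg (rel_proj R x M N))%VS.
Proof.
move=> bq; apply/vspaceP => w; apply/memv_imgP/memv_imgP => [[t _ ->]|[t _ ->]].
  exists (rel_proj R x M N t); rewrite ?(balanced_rel_proj xM1) //.
  by rewrite memv_img ?memvf.
by exists t; rewrite ?memvf.
Qed.

Lemma tdim_balanced M N (W : vectType k) (q : 'Hom(tensor M N, W)) :
  balanced R q -> (\dim (limg q) <= tdim M N)%N.
Proof. by move=> bq; rewrite (limg_balanced bq) -[X in (_ <= X)%N](limg_ker_dim q) leq_addl. Qed.

(** Right exactness of M (x)_A -. *)
Lemma tdim_sum (I : finType) M N (S : I -> smashModule A)
    (f : forall i, 'Hom(S i, N)) :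
  (forall i, smash_hom (f i)) -> (\sum_i limg (f i) = fullv)%VS ->
  (tdim M N <= \sum_i tdim M (S i))%N.
Proof.
move=> hf sf; pose P := rel_proj R x M N.
pose q i (t : tensor M (S i)) := \sw_(m, n <- t) P (m \ox f i n).
have lq i : linear (q i) by rewrite /q; lin.
have qE i m n : q i (m \ox n) = P (m \ox f i n).
  by rewrite /q sweedler_tens //; lin.
have bq i : balanced R (lfun_of (lq i)).
  move=> m c n; rewrite !lfun_ofE !qE /P (rel_proj_balanced Rqt Aqc xC).
  by rewrite hom_lmulA.
apply: (@leq_trans (\sum_i \dim (limg (lfun_of (lq i))))%N); last first.
  by apply: leq_sum => i _; apply: tdim_balanced.
apply: leq_trans (dimv_leq_sum _ _ _); apply: dimvS.
apply/subvP => _ /memv_imgP[t _ ->]; rewrite -[t]tensor_eta (sw_map P); last by lin.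
apply: sw_mem => m n.
have: n \in (\sum_i limg (f i))%VS by rewrite sf memvf.
case/memv_sumP => v vP ->.
have -> : P (m \ox (\sum_i v i)) = \sum_i P (m \ox v i).
  have l : linear (fun n => P (m \ox n)) by lin.
  by rewrite -[LHS]/(mk_lin l _) linear_sum.
apply: memv_sumr => i _; have /memv_imgP[u _ ->] := vP i isT.
by rewrite -qE -(lfun_ofE (lq i)) memv_img ?memvf.
Qed.

Lemma tdim_iso M N N' : smash_iso N N' -> (tdim M N' <= tdim M N)%N.
Proof.
move=> [f [hf [g fK gK]]].
have := @tdim_sum unit M N' (fun => N) (fun => f) (fun => hf).
rewrite !big_const card_unit /= addn0 addv0; apply.
by apply/vspaceP => n; rewrite memvf -(gK n) memv_img ?memvf.
Qed.

(** If Z consists of maps E -> X with the pointwise action of A, then m (x) F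
    |-> (e |-> m (x) F(e)) maps M (x)_A Z onto Hom(E, M (x)_A X).  The
    surjection bounds dim (M (x)_A Z) from below. *)
Lemma tdim_coHom M X (E : vectType k) (Z : smashModule A)
    (ev : 'Hom(Z, 'Hom(E, X))) :
  (forall a z e, ev (lmulA a z) e = lmulA a (ev z e)) ->
  limg ev = fullv ->
  (\dim {:E} * tdim M X <= tdim M Z)%N.
Proof.
move=> evA evS; pose p := toA_vs R x M X.
have pB : balanced R p.
  by move=> m c n; rewrite /p !comp_lfunE (rel_proj_balanced Rqt Aqc xC).
have p_surj v : exists t, v = p t.
  exists (vsval v); apply: val_inj; rewrite comp_lfunE lfunE /= vsprojK ?memv_img ?memvf //.
  by have /memv_imgP[y _ ->] := subvsP v; rewrite (rel_projK Rqt Aqc xC xM1).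
pose V : vectType k := subvs_of (limg (rel_proj R x M X)).
pose q1 m (z : Z) e : V := p (m \ox ev z e).
have q1_lin m z : linear (q1 m z) by rewrite /q1; lin.
pose q (t : tensor M Z) : 'Hom(E, V) := \sw_(m, z <- t) lfun_of (q1_lin m z).
have lq : linear q by rewrite /q; lin.
have qE m z e : q (m \ox z) e = p (m \ox ev z e).
  rewrite /q sweedler_tens; first exact: lfun_ofE.
  - move=> z' c u v; apply/lfunP => e'; rewrite add_lfunE scale_lfunE !lfun_ofE.
    by rewrite /q1 -(linearP p) (lin_tens_l _ (@lin_id _ M)).
  - move=> m' c u v; apply/lfunP => e'; rewrite add_lfunE scale_lfunE !lfun_ofE.
    have l : linear (fun z => p (m' \ox ev z e')) by lin.
    exact: l.
have bq : balanced R (lfun_of lq).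
  move=> m c z; apply/lfunP => e; rewrite !(lfun_ofE lq) !qE evA.
  exact: pB.
have dV : \dim {:V} = tdim M X by rewrite dimvf.
suff qS : limg (lfun_of lq) = fullv.
  have := tdim_balanced bq; rewrite qS; apply: leq_trans.
  by rewrite -dV !dimvf.
apply/vspaceP => G; rewrite memvf.
have lc (T : vectType k) i (v : T) : linear (fun e => coord (vbasis {:E}) i e *: v).
  by move=> c u w; rewrite linearP scalerDl scalerA.
have -> : G = \sum_i lfun_of (lc V i (G (vbasis {:E})`_i)).
  apply/lfunP => e; rewrite sum_lfunE {1}(coord_vbasis (memvf e)) linear_sum.
  by apply: eq_bigr => i _; rewrite linearZ lfun_ofE.
apply: memv_suml => i _; have [t ->] := p_surj (G (vbasis {:E})`_i).
have -> : lfun_of (lc V i (p t)) = \sw_(m, n <- t) lfun_of (lc V i (p (m \ox n))).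
  apply/lfunP => e; rewrite lfun_ofE (sw_map (fun f : 'Hom(E, V) => f e)); last by lin.
  rewrite -[in LHS](tensor_eta t) (sw_map (fun t => coord (vbasis {:E}) i e *: p t)); last by lin.
  by apply: eq_sw => m n; rewrite lfun_ofE.
apply: sw_mem => m n.
have : lfun_of (lc X i n) \in limg ev by rewrite evS memvf.
case/memv_imgP => z _ zE.
have -> : lfun_of (lc V i (p (m \ox n))) = lfun_of lq (m \ox z).
  apply/lfunP => e; rewrite lfun_ofE (lfun_ofE lq) qE -zE (lfun_ofE (lc X i n)).
  have l : linear (fun n => p (m \ox n)) by lin.
  exact: esym (lin_Z _ l _ _).
by rewrite memv_img ?memvf.
Qed.

Lemma tdim_unit M : tdim M (unit_smash A) = \dim {:M}.
Proof.
apply/eqP; rewrite eqn_leq; apply/andP; split.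
  pose f m := rel_proj R x M (unit_smash A) (m \ox (1 : A)).
  have lf : linear f by rewrite /f; lin.
  apply: (@leq_trans (\dim (limg (lfun_of lf)))); last first.
    by rewrite -[X in (_ <= X)%N](limg_ker_dim (lfun_of lf)) leq_addl.
  apply: dimvS; apply/subvP => _ /memv_imgP[t _ ->].
  rewrite -[t]tensor_eta (sw_map (rel_proj R x M (unit_smash A))); last by lin.
  apply: sw_mem => m a.
  have -> : m \ox a = m \ox (lmulA (a : A) (1 : unit_smash A)).
    by congr (_ \ox _); rewrite build_lmulA [RHS]mulr1.
  rewrite -(rel_proj_balanced Rqt Aqc xC) -/(f _) -(lfun_ofE lf).
  by rewrite memv_img ?memvf.
pose q (t : tensor M (unit_smash A)) := \sw_(m, a <- t) rmulA R m (a : A).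
have lq : linear q by rewrite /q; lin.
have qE m (a : unit_smash A) : q (m \ox a) = rmulA R m (a : A).
  by rewrite /q sweedler_tens // => y; lin.
have bq : balanced R (lfun_of lq).
  move=> m c a; rewrite !lfun_ofE !qE -(rmulAM Rqt Aqc).
  by rewrite build_lmulA.
have := tdim_balanced bq; suff -> : limg (lfun_of lq) = fullv by [].
apply/vspaceP => m; rewrite memvf; apply/memv_imgP.
exists (m \ox (1 : unit_smash A)); first exact: memvf.
by rewrite lfun_ofE qE (rmulA1 Rqt).
Qed.
End Dim.

(** * Frobenius-Perron eigenvalues *)

Section PF.
Context (r : nat) (L : 'M[nat]_r).
Let LC : 'M[algC]_r := map_mx (fun n => n%:R) L.

(** If v L = e v with e > 0, then e |v| <= |v| L entrywise; pairing with the
    positive eigenvector d gives e <= c.  That c is an eigenvalue on the side of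
    row vectors follows from the transposed matrix. *)
Lemma PF_largest (d : 'I_r -> nat) (c : algC) (i0 : 'I_r) :
  (forall i, 0 < d i)%N -> 0 < c ->
  (forall i, (\sum_j L i j * d j)%N%:R = c * (d i)%:R) ->
  largest_positive_eigenvalue L c.
Proof.
move=> d0 c0 Ld; split=> //.
  pose D : 'rV[algC]_r := \row_j (d j)%:R.
  have : \det (LC - c%:M) == 0.
    rewrite -det_tr; apply/det0P; exists D.
      apply/eqP => /rowP/(_ i0)/eqP; rewrite !mxE pnatr_eq0.
      by rewrite eqn0Ngt d0.
    rewrite raddfB /= mulmxBr tr_scalar_mx mul_mx_scalar.
    apply/rowP => i; rewrite !mxE -Ld natr_sum; apply/eqP; rewrite subr_eq0.
    by apply/eqP; apply: eq_bigr => j _; rewrite !mxE natrM mulrC.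
  case/det0P => v v0 /eqP; rewrite mulmxBr mul_mx_scalar subr_eq0 => /eqP E.
  by apply/eigenvalueP; exists v.
move=> e /eigenvalueP[v vL v0] e0.
have le j : e * `|v 0 j| <= \sum_i `|v 0 i| * (L i j)%:R.
  have := congr1 (fun w : 'rV_r => w 0 j) vL; rewrite !mxE => E.
  rewrite -{1}(gtr0_norm e0) -normrM -E; apply: le_trans (ler_norm_sum _ _ _) _.
  by apply: ler_sum => i _; rewrite !mxE normrM normr_nat.
pose s := \sum_j `|v 0 j| * (d j)%:R.
have s0 : 0 < s.
  have [j vj] : exists j, v 0 j != 0.
    by apply/existsP; apply: contraR v0 => /existsPn E; apply/eqP/rowP => j;
      rewrite mxE; apply/eqP; rewrite -[_ == _]negbK E.
  rewrite /s (bigD1 j) //= ltr_pwDl ?sumr_ge0 //.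
  - by rewrite mulr_gt0 ?normr_gt0 ?ltr0n.
  - by move=> i _; rewrite mulr_ge0.
rewrite -(ler_pM2r s0) /s !mulr_sumr.
apply: (@le_trans _ _ (\sum_j (\sum_i `|v 0 i| * (L i j)%:R) * (d j)%:R)).
  by apply: ler_sum => j _; rewrite mulrA ler_wpM2r.
under eq_bigr => j _ do rewrite mulr_suml.
rewrite exchange_big /=; apply: ler_sum => i _.
rewrite mulrCA -Ld natr_sum mulr_sumr; apply: ler_sum => j _.
by rewrite natrM mulrA.
Qed.

(** The eigenvalue is a rational root of a monic polynomial with integer
    coefficients. *)
Lemma eigenvalue_nat (n m : nat) : (0 < m)%N ->
  eigenvalue LC (n%:R / m%:R) -> (m %| n)%N.
Proof.
move=> m0 ev; pose c : algC := n%:R / m%:R.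
have cA : c \in Aint.
  apply: (root_monic_Aint (p := char_poly LC)).
  - by rewrite -eigenvalue_root_char.
  - exact: char_poly_monic.
  pose LZ : 'M[int]_r := map_mx Posz L.
  have -> : LC = map_mx intr LZ by apply/matrixP => i j; rewrite !mxE.
  rewrite -map_char_poly; apply/polyOverP => i; rewrite coef_map /=.
  exact: intr_int.
have cQ : c \in Crat by rewrite rpredM ?rpredV ?rpred_nat.
have := Cint_rat_Aint cQ cA; rewrite intrEge0 ?divr_ge0 // => /natrP[q qE].
apply/dvdnP; exists q; apply/eqP; rewrite -(eqr_nat algC) natrM -qE /c.
by rewrite divfK // pnatr_eq0 -lt0n.
Qed.
End PF.

(** * The multiplicativity of dimensions *)

Section Main.
Context (k : fieldType) (H : hopfAlgebra k) (R : tensor H H).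
Context (A : moduleAlgebra H).
Implicit Types (g h : H) (a b c : A) (M N X : smashModule A).
Hypothesis Rqt : quasitriangular R.
Hypothesis Aqc : quantum_commutative A R.
Hypothesis Asimple : H_simple A.
Variable x : tensor A A.
Hypothesis xC : forall a, \sw_(x1, x2 <- x) ((a * x1) \ox x2) =
                          \sw_(x1, x2 <- x) (x1 \ox (x2 * a)).
Hypothesis xM1 : \sw_(x1, x2 <- x) (x1 * x2) = 1.
Variable t : H.
Hypothesis t1 : counit t = 1.
Hypothesis tR : forall h, t * h = counit h *: t.

(** The family of the maps coinduced from [sep_fun f], over all linear f, as a
    single map into a power; its kernel is a submodule on which every
    [sep_fun f] vanishes. *)
Lemma coinduced_embed N X : fullv <> 0%VS :> {vspace X} ->
  exists (E : vectType k) (f : 'Hom(N, smash_power E (coinduced X))),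
    smash_hom f /\ injective f.
Proof.
move=> X0; pose sep (f : 'Hom(N, X)) : 'Hom(N, X) := lfun_of (sep_fun_lin2 x f).
pose phi (f : 'Hom(N, X)) := to_coinduced (sep f).
have phi_hom f : smash_hom (phi f).
  by apply: to_coinduced_hom => a m; rewrite !lfun_ofE sep_fun_lmulA.
have phi_lin : linear phi.
  move=> c u v; apply/lfunP => n; rewrite add_lfunE scale_lfunE.
  apply/lfunP => h; rewrite to_coinducedE add_lfunE scale_lfunE !to_coinducedE.
  have l : linear (fun f => to_coinduced_fun (sep f) n h).
    rewrite /to_coinduced_fun; apply: lin_sw => y z; apply: lin_hact_r.
    by move=> c' u' v'; rewrite /sep !lfun_ofE sep_fun_lin1.
  exact: l.
(* The exponent is the space of all linear maps from N to X. *)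
pose iota := family_hom phi_lin.
have hiota : smash_hom iota := family_hom_hom phi_lin phi_hom.
exists _, iota; split=> //; apply/lker0P; apply/eqP.
apply: (sep_nondeg xM1 Asimple X0); first exact: lker_invariant hiota.
move=> f n; rewrite memv_ker => /eqP n0.
rewrite -(lfun_ofE (sep_fun_lin2 x f)) -to_coinduced_fun1 -to_coinducedE -/(sep f) -/(phi f).
by rewrite -(family_homE phi_lin) -/iota n0 zero_lfunE zero_lfunE.
Qed.

Notation tdim := (tdim R x).

Lemma dim_coinduced X (E : vectType k) :
  \dim {:smash_power E (coinduced X)} = (\dim {:E} * (\dim {:H} * \dim {:X}))%N.
Proof. by rewrite !dimvf. Qed.

Lemma tdim_coinduced M X (E : vectType k) :
  (\dim {:E} * (\dim {:H} * tdim M X) <= tdim M (smash_power E (coinduced X)))%N.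
Proof.
apply: (@leq_trans (\dim {:E} * tdim M (coinduced X))%N).
  rewrite leq_mul2l; apply/orP; right.
  apply: (@tdim_coHom _ _ _ _ Rqt Aqc _ xC xM1 M X H (coinduced X) \1%VF); last by rewrite lim1g.
  by move=> a z e; rewrite !id_lfunE coHom_lmulA.
apply: (@tdim_coHom _ _ _ _ Rqt Aqc _ xC xM1 M (coinduced X) E
  (smash_power E (coinduced X)) \1%VF); last by rewrite lim1g.
by move=> a z e; rewrite !id_lfunE coHom_lmulA.
Qed.

(** Numerical form of the extremal argument: Z splits as N + U, its dimension is
    e dim X and its ratio is at least that of X, while U obeys the upper
    bound. *)
Lemma squeeze (e tZ tN tU tX dN dU dX : nat) :
  (tZ <= tN + tU)%N -> (dN + dU = e * dX)%N -> (e * tX <= tZ)%N ->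
  (tU * dX <= tX * dU)%N -> (tX * dN <= tN * dX)%N.
Proof.
move=> le1 dE le2 le3; rewrite -(leq_add2r (tX * dU)) -mulnDr dE.
apply: (@leq_trans (tZ * dX)).
  by rewrite mulnA (mulnC tX) leq_mul2r le2 orbT.
apply: leq_trans (leq_mul le1 (leqnn _)) _.
by rewrite mulnDl leq_add2l.
Qed.

Lemma tdim_lower M X N : fullv <> 0%VS :> {vspace X} ->
  (forall N', tdim M N' * \dim {:X} <= tdim M X * \dim {:N'})%N ->
  (tdim M X * \dim {:N} <= tdim M N * \dim {:X})%N.
Proof.
move=> X0 ub; have [E [f [hf fi]]] := coinduced_embed N X0.
set Z := smash_power E (coinduced X) in f hf fi *.
have [U' [iU' U'0 sU']] := inv_compl xC xM1 t1 tR (limg_invariant hf).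
pose S (b : bool) := if b then N else sub_smash iU'.
pose F (b : bool) : 'Hom(S b, Z) := match b with true => f | false => sub_incl iU' end.
have le1 : (tdim M Z <= tdim M N + tdim M (sub_smash iU'))%N.
  have := @tdim_sum _ _ _ _ Rqt Aqc _ xC xM1 bool M Z S F.
  rewrite !big_bool /F limg_sub_incl; apply=> //.
  by case; [exact: hf | exact: sub_incl_hom].
have dZ : \dim {:Z} = (\dim {:N} + \dim {:sub_smash iU'})%N.
  by rewrite dim_sub_smash -(inj_hom_dim fi) -dimv_disjoint_sum // sU'.
apply: (squeeze (e := \dim {:E} * \dim {:H}) le1 _ _ (ub (sub_smash iU'))).
  by rewrite -dZ dim_coinduced mulnA.
by rewrite -mulnA; apply: tdim_coinduced.
Qed.

(** The maximum is taken over the finitely many simple modules; it bounds the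
    ratio of every module by [tdim_sum]. *)
Lemma exists_extremal M : exists X0,
  fullv <> 0%VS :> {vspace X0} /\
  forall N, (tdim M N * \dim {:X0} <= tdim M X0 * \dim {:N})%N.
Proof.
have [r [X XP]] := exists_simple_system xC xM1 t1 tR Asimple.
have [Xs _ Xc] := XP.
have d0 j : (0 < \dim {:X j})%N by apply/full_neq0; have [] := Xs j.
have [j1 _] : exists j1 : 'I_r, True.
  have [n [S [f [fP _ fd]]]] := simple_decomp xC xM1 t1 tR (unit_smash A).
  have n0 : (0 < n)%N.
    case: n S f fP fd => // S f _; rewrite big_ord0 => E.
    by have /full_neq0 := @unit_neq0 _ _ A; rewrite E.
  by have [j _] := Xc _ (proj1 (fP (Ordinal n0))); exists j.
pose ratio j : rat := (tdim M (X j))%:R / (\dim {:X j})%:R.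
have [j0 _ max0] := @arg_maxP _ _ _ j1 xpredT ratio isT.
have ub1 j : (tdim M (X j) * \dim {:X j0} <= tdim M (X j0) * \dim {:X j})%N.
  have := max0 j isT; rewrite /= /ratio ler_pdivrMr ?ltr0n // mulrAC.
  by rewrite ler_pdivlMr ?ltr0n // -!natrM ler_nat.
exists (X j0); split; first by have [] := Xs j0.
move=> N; have [n [S [f [fP fE ->]]]] := simple_decomp xC xM1 t1 tR N.
have hf i : smash_hom (f i) by have [_ []] := fP i.
have := tdim_sum Rqt Aqc xC xM1 M hf fE.
rewrite -(leq_pmul2r (d0 j0)) big_distrl big_distrr /=.
move/leq_trans; apply; apply: leq_sum => i _.
have [j ij] := Xc _ (proj1 (fP i)).
have dE : \dim {:S i} = \dim {:X j}.
  have [g [_ [g' gK g'K]]] := ij; rewrite -(inj_hom_dim (can_inj gK)).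
  congr (\dim _); apply/vspaceP => v; rewrite memvf.
  by rewrite -[v]g'K memv_img ?memvf.
rewrite dE; apply: leq_trans (ub1 j); rewrite leq_mul2r.
by rewrite (tdim_iso Rqt Aqc xC xM1 M (smash_iso_sym ij)) orbT.
Qed.

Lemma tdim_mul M N : (tdim M N * \dim {:A} = \dim {:M} * \dim {:N})%N.
Proof.
have [X [X0 ub]] := exists_extremal M.
have eqX N' : (tdim M N' * \dim {:X} = tdim M X * \dim {:N'})%N.
  by apply/eqP; rewrite eqn_leq ub tdim_lower.
have dX : (0 < \dim {:X})%N by apply/full_neq0.
have := eqX (unit_smash A); rewrite (tdim_unit Rqt Aqc xC xM1) => EA.
apply/eqP; rewrite -(eqn_pmul2r dX) mulnAC eqX mulnAC.
rewrite -[X in X * _ == _]/(tdim M X * \dim {:unit_smash A})%N -EA.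
by rewrite mulnAC.
Qed.

End Main.

(** * Frobenius-Perron dimensions of A#H-modules *)

Theorem theorem3p12 (k : fieldType) (k_char0 : [pchar k] =i pred0)
    (H : hopfAlgebra k) (R : tensor H H)
    (H_semisimple : semisimple_algebra H) (R_qt : quasitriangular R)
    (A : moduleAlgebra H)
    (A_separable : strongly_separable A)
    (A_qcomm : quantum_commutative A R)
    (A_simple : H_simple A)
    (u_trivial : forall a : A, act (drinfeld R) a = a)
    (V : smashModule A) (V_neq0 : fullv <> 0%VS :> {vspace V}) :
  (\dim {:A} %| \dim {:V})%N /\
  is_FPdim R V ((\dim {:V})%:R / (\dim {:A})%:R).
Proof.
have [x [xC xM1 _]] := A_separable.
have [t [t1 _ tR]] := exists_integral H_semisimple.
have [r [X XP]] := exists_simple_system xC xM1 t1 tR A_simple.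
have [Xs _ Xc] := XP.
have dA : (0 < \dim {:A})%N by apply/(full_neq0 (unit_smash A)); apply: unit_neq0.
have dV : (0 < \dim {:V})%N by apply/full_neq0.
have dX i : (0 < \dim {:X i})%N by apply/full_neq0; have [] := Xs i.
have [i0 _] : exists i0 : 'I_r, True.
  have [n [S [f [fP _ fd]]]] := simple_decomp xC xM1 t1 tR V.
  have n0 : (0 < n)%N.
    case: n S f fP fd => // S f _; rewrite big_ord0 => E.
    by move: dV; rewrite E.
  by have [j _] := Xc _ (proj1 (fP (Ordinal n0))); exists j.
pose c : algC := (\dim {:V})%:R / (\dim {:A})%:R.
have c0 : 0 < c by rewrite divr_gt0 ?ltr0n.
have mul_exists M N : exists e : 'I_r -> nat, Gr_mul R X M N e /\
    (tdim R x M N = \sum_j e j * \dim {:X j})%N.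
  have [e eP] := Gr_class_exists xC xM1 t1 tR (toA R_qt A_qcomm xC xM1 M N) XP.
  exists e; split; last by rewrite -(Gr_class_dim eP) dim_toA.
  by exists (toA R_qt A_qcomm xC xM1 M N), (toA_proj R_qt A_qcomm xC xM1 M N);
    split=> //; apply: toA_tensor.
(* Both factors of the product are left free, so that the matrices of left
   and of right multiplication are obtained at once. *)
have mx_exists (F : 'I_r -> smashModule A * smashModule A) :
    (forall i, \dim {:(F i).1} * \dim {:(F i).2} = \dim {:V} * \dim {:X i})%N ->
    exists L : 'M[nat]_r, (forall i, Gr_mul R X (F i).1 (F i).2 (L i)) /\
      largest_positive_eigenvalue L c.
  move=> dF; have [e eP] := fin_all_exists (fun i => mul_exists (F i).1 (F i).2).
  pose L : 'M[nat]_r := \matrix_(i, j) e i j.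
  have LE i : L i = e i by apply: functional_extensionality => j; rewrite mxE.
  exists L; split=> [i|]; first by rewrite LE; have [] := eP i.
  apply: (@PF_largest _ _ (fun i => \dim {:X i})) => // i.
  have [_] := eP i; rewrite -LE => <-; rewrite /c mulrAC.
  have dA0 : (\dim {:A})%:R != 0 :> algC by rewrite pnatr_eq0 -lt0n.
  apply: (mulIf dA0); rewrite divfK // -!natrM.
  by rewrite (tdim_mul R_qt A_qcomm A_simple xC xM1 t1 tR) dF.
have [L [LP Lc]] := mx_exists (fun i => (V, X i)) (fun i => erefl).
have [L' [LP' Lc']] := mx_exists (fun i => (X i, V)) (fun i => mulnC _ _).
split; last by exists r, X, L, L'; split.
by have [ev _ _] := Lc; apply: eigenvalue_nat ev.
Qed.
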